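(* (Strict primal unboundedness detector.) Let the setting, the starting data $z^0,y^0$, the quantities $t_d(y^0)$, $B_{d,0}$ and the algorithm PtPCA be as defined in the context. Assume that the primal problem $\inf\{\langle c,x\rangle:Ax\in D\}$ is strictly unbounded. Then, for every $\epsilon>0$, after running the PtPCA algorithm at most $$O\left(\sqrt{\vartheta}\,\ln\left(\frac{1}{\vartheta\epsilon}t_d(y^0)+t_d(y^0)B_{d,0}\right)\right)$$ iterations, the projection of $u:=Ax+\frac1\tau z^0$, for the current point $(x,\tau,y)$, with respect to the norm defined by $\Phi''(u)$, into the set $\{z: z=Ax',\ x'\in\mathbb R^n,\ \langle c,x'\rangle\le-1/\epsilon\}$ yields a point $\bar x\in\mathbb R^n$ (the projection being $A\bar x$) such that $A\bar x\in\operatorname{int}(D)$ and $\langle c,\bar x\rangle\le-\frac1\epsilon$.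
   Context: Setting. $A:\mathbb R^n\to\mathbb R^m$ is linear with kernel $\{0\}$, $c\in\mathbb R^n$, and $D\subset\mathbb R^m$ is a closed convex set with nonempty interior, given as the closure of the domain of a $\vartheta$-self-concordant barrier $\Phi$. Let $\operatorname{rec}(D)$ be the recession cone of $D$ and $D_*:=\{y\in\mathbb R^m:\langle y,h\rangle\le0\ \forall h\in\operatorname{rec}(D)\}$. The Legendre-Fenchel conjugate of $\Phi$ is $\Phi_*(y)=\sup_z\{\langle y,z\rangle-\Phi(z)\}$; its domain is $\operatorname{int}D_*$. Strictly unbounded means: there exist $x\in\mathbb R^n$ with $Ax\in\operatorname{int}D$ and $h\in\mathbb R^n$ with $Ah\in\operatorname{int}(\operatorname{rec}(D))$ and $\langle c,h\rangle<0$. Starting data. $\xi>1$ is a fixed absolute constant, $z^0$ is any vector in $\operatorname{int}D$, $y^0:=\Phi'(z^0)$, $y_{\tau,0}:=-\langle y^0,z^0\rangle-\xi\vartheta$. Define $$Q_{DD}:=\{(x,\tau,y): Ax+\tfrac1\tau z^0\in\operatorname{int}D,\ \tau>0,\ A^\top y-A^\top y^0=-(\tau-1)c,\ y\in\operatorname{int}D_*\},$$ and for $(x,\tau,y)\in Q_{DD}$ $$\mu(x,\tau,y):=\frac{\tau}{\xi\vartheta}\Big[-y_{\tau,0}-\tau\langle c,x\rangle-\langle y,Ax+\tfrac1\tau z^0\rangle\Big].$$ For a positive definite $B$, the norm defined by $B$ is $\|v\|_{B}:=\langle Bv,v\rangle^{1/2}$. A point $(x,\tau,y)\in Q_{DD}$,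 with $\mu:=\mu(x,\tau,y)$, is $\kappa$-close to the central path if $\big\|Ax+\tfrac1\tau z^0-\Phi_*'(\tfrac\tau\mu y)\big\|_{[\Phi_*''(\frac\tau\mu y)]^{-1}}\le\kappa$. It is assumed throughout that the neighborhoods are chosen such that $\xi-1-\kappa>0$. Quantities. $t_d(y^0):=\sup\{t\ge1:\exists y\in D_* \text{ s.t. } A^\top y-A^\top y^0=-(t-1)c\}$, and $B_{d,t}:=\sup\{\|y\|: y\in D_*,\ \exists\tau\in(t,t_d(y^0)) \text{ s.t. } A^\top y=A^\top y^0-(\tau-1)c\}$, used here with $t=0$. Algorithm. PtPCA (polynomial-time predictor-corrector algorithm) is a path-following algorithm that generates points $(x,\tau,y)\in Q_{DD}$ that are $\kappa$-close to the central path, and there is a positive absolute constant $\gamma$ depending on $\xi$ such that after $N$ iterations the returned point satisfies $\mu(x,\tau,y)\ge\exp(\gamma N/\sqrt\vartheta)$.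
   Formalization: The neighborhood size is also assumed to satisfy κ<1 (the claim fails for large κ, e.g. ξ=20, κ=10), and the O-constant depends on ξ, κ, γ, ‖z⁰‖ and ‖y⁰‖, since no absolute constant can work. *)

(* Defs.v *)
From mathcomp Require Import all_boot all_order all_algebra.
From mathcomp Require Import all_classical all_reals all_analysis.

Set Implicit Arguments.
Unset Strict Implicit.
Unset Printing Implicit Defensive.

Import Order.TTheory GRing.Theory Num.Theory.
Import numFieldNormedType.Exports.

Local Open Scope classical_set_scope.
Local Open Scope ring_scope.

(* Vectors are rows: the linear map A : R^n -> R^m is x |-> x *m A with
   A : 'M_(n, m), and its adjoint is y |-> y *m A^T. *)

Section Calculus.
Context {R : realType}.

Definition dot {k : nat} (u v : 'rV[R]_k) : R := (u *m v^T) 0 0.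

(* The norm of the library on 'rV_k is the sup norm; it gives the same
   topology, but not the same numbers. *)
Definition enorm {k : nat} (v : 'rV[R]_k) : R := Num.sqrt (dot v v).

Definition norm_by {k : nat} (B : 'M[R]_k) (v : 'rV[R]_k) : R :=
  Num.sqrt (dot (v *m B) v).

Definition grad {k : nat} (f : 'rV[R]_k -> R) (z : 'rV[R]_k) : 'rV[R]_k :=
  \row_i 'D_(delta_mx 0 i) f z.

Definition hess {k : nat} (f : 'rV[R]_k -> R) (z : 'rV[R]_k) : 'M[R]_k :=
  \matrix_(i, j) 'D_(delta_mx 0 j) ('D_(delta_mx 0 i) f) z.

Fixpoint C_on {k : nat} (r : nat) (U : set 'rV[R]_k) (f : 'rV[R]_k -> R) :
    Prop :=
  (forall z, U z -> {for z, continuous f}) /\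
  if r is r'.+1 then
    forall h, (forall z, U z -> derivable f z h) /\ C_on r' U ('D_h f)
  else True.

(* A nearest point of S to u in the norm defined by B. *)
Definition is_projection {k : nat} (B : 'M[R]_k) (S : set 'rV[R]_k)
    (u p : 'rV[R]_k) : Prop :=
  S p /\ forall q, S q -> norm_by B (u - p) <= norm_by B (u - q).

End Calculus.

Section Barriers.
Context {R : realType} {m : nat}.
Implicit Types (D : set 'rV[R]_m) (Phi : 'rV[R]_m -> R).

(* Only the values of Phi on the interior of D matter; Phi is understood to
   be +oo elsewhere. *)
Definition self_concordant D Phi : Prop :=
  [/\ C_on 3 D° Phi,
      convex_function (D° : set (convex_lmodType 'rV[R]_m)) Phi,
      forall z h, D° z ->
        `|'D_h ('D_h ('D_h Phi)) z| <= 2 * Num.sqrt ('D_h ('D_h Phi) z) ^+ 3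
    & forall z, D z -> ~ D° z ->
        Phi x @[x --> within D° (nbhs z)] --> +oo].

Definition self_concordant_barrier D Phi (theta : R) : Prop :=
  [/\ self_concordant D Phi, 1 <= theta &
      forall z h, D° z ->
        `|'D_h Phi z| <= Num.sqrt theta * Num.sqrt ('D_h ('D_h Phi) z)].

Definition rec D : set 'rV[R]_m :=
  [set h | forall z t, D z -> 0 <= t -> D (z + t *: h)].

Definition Dstar D : set 'rV[R]_m :=
  [set y | forall h, rec D h -> dot y h <= 0].

(* Meaningful on the domain of the conjugate, where the supremum is finite. *)
Definition conjugate D Phi (y : 'rV[R]_m) : R :=
  sup [set dot y z - Phi z | z in D°].

End Barriers.

Section DomainDriven.
Context {R : realType} {m n : nat}.
Variables (D : set 'rV[R]_m) (Phi : 'rV[R]_m -> R) (theta : R).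
Variables (A : 'M[R]_(n, m)) (c : 'rV[R]_n).

Definition strictly_unbounded : Prop :=
  (exists x : 'rV[R]_n, D° (x *m A)) /\
  (exists h : 'rV[R]_n, (rec D)° (h *m A) /\ dot c h < 0).

Definition t_d (y0 : 'rV[R]_m) : \bar R :=
  ereal_sup [set t%:E | t in [set t : R | 1 <= t /\
    exists y, Dstar D y /\ y *m A^T - y0 *m A^T = - ((t - 1) *: c)]].

Definition B_d (y0 : 'rV[R]_m) (t : R) : \bar R :=
  ereal_sup [set (enorm y)%:E | y in [set y | Dstar D y /\
    exists tau : R, [/\ t < tau, (tau%:E < t_d y0)%E &
      y *m A^T = y0 *m A^T - (tau - 1) *: c]]].

Section StartingData.
Variables (xi : R) (z0 : 'rV[R]_m).
Let y0 := grad Phi z0.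

Definition y_tau0 : R := - dot y0 z0 - xi * theta.

Definition primal_point (x : 'rV[R]_n) (tau : R) : 'rV[R]_m :=
  x *m A + tau^-1 *: z0.

Definition Q_DD : set ('rV[R]_n * R * 'rV[R]_m) :=
  [set p | let: (x, tau, y) := p in
    [/\ D° (primal_point x tau), 0 < tau,
        y *m A^T - y0 *m A^T = - ((tau - 1) *: c) & (Dstar D)° y]].

Definition mu (p : 'rV[R]_n * R * 'rV[R]_m) : R :=
  let: (x, tau, y) := p in
  tau / (xi * theta) *
    (- y_tau0 - tau * dot c x - dot y (primal_point x tau)).

Definition close_to_path (kappa : R) (p : 'rV[R]_n * R * 'rV[R]_m) : Prop :=
  let: (x, tau, y) := p in
  let w := (tau / mu p) *: y in
  norm_by (invmx (hess (conjugate D Phi) w))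
    (primal_point x tau - grad (conjugate D Phi) w) <= kappa.

(* [run N] is the point returned by the path-following algorithm after N
   iterations; all that is known about the algorithm is its guarantee. *)
Definition PtPCA_run (kappa gamma : R)
    (run : nat -> 'rV[R]_n * R * 'rV[R]_m) : Prop :=
  forall N : nat, [/\ Q_DD (run N), close_to_path kappa (run N) &
    expR (gamma * N%:R / Num.sqrt theta) <= mu (run N)].

(* sqrt theta * ln (...), the complexity inside the O-symbol. The maximum with
   1 gives O(ln X) its usual meaning when X is below e; [t_d] and [B_d]
   are finite for strictly unbounded problems. *)
Definition detector_complexity (eps : R) : R :=
  let T := fine (t_d y0) in
  Num.sqrt theta *
    Num.max 1 (ln (1 / (theta * eps) * T + T * fine (B_d y0 0))).

Definition improving_set (eps : R) : set 'rV[R]_m :=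
  [set x *m A | x in [set x : 'rV[R]_n | dot c x <= - (1 / eps)]].

Definition is_detected_point (eps : R) (p : 'rV[R]_n * R * 'rV[R]_m)
    (xbar : 'rV[R]_n) : Prop :=
  let: (x, tau, _) := p in
  let u := primal_point x tau in
  is_projection (hess Phi u) (improving_set eps) u (xbar *m A).

End StartingData.

End DomainDriven.

(* Main.v *)
(* Let u be the current primal point, w = (tau / mu) y, and z the point of int D
   with Phi'(z) = w; closeness to the central path says |u - z|_z <= kappa.

   A recession direction h satisfies |h|_u <= - <Phi'(u), h>, and along the
   segment from z to u the quantity - <Phi', h> grows by a factor at most
   1 / (1 - kappa); hence |h|_u <= - <w, h> / (1 - kappa). In other words w can be
   moved by 1 - kappa in the dual norm at u without leaving D_*.

   The definition of mu together with <w, z0 - z> <= theta shows that - <c, x>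
   exceeds 1 / eps by a margin of order theta mu / tau ^ 2.

   Let r be the residual of the projection of u onto the improving set and
   eta = Phi''(u) r; by the optimality conditions A^T eta = l c with l >= 0. Moving
   y along eta keeps it dual feasible, with a smaller tau, so the definition of
   B_(d,0) bounds |eta|. Since |r|_u ^ 2 = <eta, z0> / tau - l (margin), this gives
   |r|_u < 1 as soon as mu dominates a polynomial in t_d, B_(d,0) and
   1 / (theta eps), and then the projection lies in the Dikin ellipsoid of u,
   hence in int D. *)
Require Import Defs.
From mathcomp Require Import all_boot all_order all_algebra.
From mathcomp Require Import all_classical all_reals all_analysis.
From mathcomp Require Import ring lra.
Import Order.TTheory GRing.Theory Num.Theory.
Import numFieldNormedType.Exports.
Local Open Scope classical_set_scope.
Local Open Scope ring_scope.

(** * Directional derivatives *)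

(** [C_on] only prescribes directional derivatives and their continuity, so linearity in the
    direction and symmetry of second derivatives have to be derived before a gradient and a Hessian
    matrix can be used. [close_to_path] is phrased with the gradient and Hessian of a supremum.
    Reading it as a local norm at [z] requires the existence of [z], obtained from compactness of
    superlevel sets, and the derivatives of the conjugate, obtained by direct estimates on the
    inverse of [grad Phi]. The Hessian of [Phi] is invertible because the polar cone has an interior
    point: this excludes lines in [D], whereas a direction of zero local norm would generate one.
    The move of [y] along eta is limited twice, by the dual-norm margin and by positivity of the new
    tau. When the second limit binds, [l] is so large that the term with the objective margin
    outweighs <eta, z0> / tau. Hence lower bounds are needed both on mu and on the margin. Strict
    unboundedness enters through the direction [h]: pairing the dual equation with [h *m A] bounds
    tau and [y] at once. *)

Lemma is_deriveP {R : realType} {V : normedModType R} (f : V -> R) (a v : V)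
    (l : R) :
  is_derive a v f l <-> forall e : R, 0 < e -> exists2 d : R, 0 < d &
    forall t, `|t| < d -> `|f (a + t *: v) - f a - t * l| <= e * `|t|.
Proof.
have key t : t != 0 ->
    `|f (a + t *: v) - f a - t * l| =
    `|l - t^-1 *: ((f \o shift a) (t *: v) - f a)| * `|t|.
  move=> t0; rewrite distrC -normrM mulrBl /= [t *: v + a]addrC [l * t]mulrC.
  by rewrite [_ *: _ * _]mulrC [t * (_ *: _)]mulrA divff// mul1r.
split=> [[df dfl] e e0|H].
  move: df; rewrite /derivable -/(derive f a v) => df.
  have : (fun h => h^-1 *: ((f \o shift a) (h *: v) - f a)) @ 0^' --> l.
    by rewrite -dfl; exact: df.
  move=> /cvgrPdist_le /(_ e e0); rewrite near_withinE near_nbhs.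
  move=> /nbhs_ballP[d /= d0 dP]; exists d => // t td.
  have [->|t0] := eqVneq t 0.
    by rewrite scale0r addr0 subrr sub0r mul0r oppr0 normr0 mulr0.
  rewrite key// ler_wpM2r//; apply: dP => //.
  by rewrite /ball/= sub0r normrN.
have cv : (fun h => h^-1 *: ((f \o shift a) (h *: v) - f a)) @ 0^' --> l.
  apply/cvgrPdist_le => e e0; rewrite near_withinE near_nbhs.
  have [d d0 dP] := H e e0; apply/nbhs_ballP; exists d => //= t.
  rewrite /ball/= sub0r normrN => td t0.
  have := dP t td; rewrite key// ler_pM2r// normr_gt0//.
by apply: DeriveDef; [apply/cvg_ex; exists l | exact: cvg_lim cv].
Qed.

Lemma is_derive_line {R : realType} {V : normedModType R} (f : V -> R)
    (z v : V) (t : R) :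
  derivable f (z + t *: v) v ->
  is_derive t 1 (fun s => f (z + s *: v)) ('D_v f (z + t *: v)).
Proof.
move=> df; apply/is_deriveP => e e0.
have [d d0 dP] := (is_deriveP f (z + t *: v) v _).1 (derivableP df) e e0.
exists d => // s sd; have := dP s sd.
by rewrite scalerDl addrA [s *: 1]mulr1.
Qed.

Lemma MVT_cc {R : realType} (f df : R -> R) (a b : R) : a < b ->
  (forall x, a <= x <= b -> is_derive x 1 f (df x)) ->
  exists2 c, a < c < b & f b - f a = df c * (b - a).
Proof.
move=> ab fdf; have [c] : exists2 c, c \in `]a, b[%R & f b - f a = df c * (b - a).
  apply: MVT => // [x|]; first by rewrite in_itv/= => /andP[? ?]; apply: fdf;
    rewrite !ltW.
  apply: derivable_within_continuous => x; rewrite in_itv/= => xab.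
  exact: (ex_derive (is_derive := fdf x xab)).
by rewrite in_itv/= => cab ->; exists c.
Qed.

Lemma MVT_line {R : realType} {V : normedModType R} (f : V -> R) (z v : V) :
  (forall s, 0 <= s <= 1 -> derivable f (z + s *: v) v) ->
  exists2 s, 0 < s < 1 & f (z + v) - f z = 'D_v f (z + s *: v).
Proof.
move=> df.
have [s s01] := MVT_cc (fun s => f (z + s *: v))
  (fun s => 'D_v f (z + s *: v)) 0 1 ltr01
  (fun s s01 => is_derive_line _ _ _ _ (df s s01)).
by rewrite scale1r scale0r addr0 subr0 mulr1 => ->; exists s.
Qed.

Lemma is_deriveZ_dir {R : realType} {V : normedModType R} (f : V -> R)
    (z v : V) (t : R) :
  derivable f z v -> is_derive z (t *: v) f (t * 'D_v f z).
Proof.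
move=> df; apply/is_deriveP => e e0.
have e1 : 0 < e / (`|t| + 1) by rewrite divr_gt0// ltr_wpDl.
have [d d0 dP] := (is_deriveP f z v _).1 (derivableP df) _ e1.
exists (d / (`|t| + 1)); first by rewrite divr_gt0// ltr_wpDl.
move=> s; rewrite ltr_pdivlMr ?ltr_wpDl// => sd.
have /dP : `|s * t| < d.
  rewrite normrM (le_lt_trans _ sd)// ler_wpM2l// lerDl//.
rewrite scalerA mulrA => /le_trans; apply.
rewrite normrM.
have -> : e / (`|t| + 1) * (`|s| * `|t|) = e * `|s| * (`|t| / (`|t| + 1)).
  by ring.
apply: ler_piMr; first by rewrite mulr_ge0// ltW.
by rewrite ler_pdivrMr ?ltr_wpDl// mul1r lerDl.
Qed.

Lemma nbhs_shift {R : realType} {V : normedModType R} (z : V) (P : set V) :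
  nbhs z P -> exists2 d : R, 0 < d & forall w, `|w| < d -> P (z + w).
Proof.
move=> /nbhs_ballP[d /= d0 dP]; exists d => // w wd; apply: dP.
by rewrite -ball_normE/= opprD addrA subrr sub0r normrN.
Qed.

Lemma norm_entry {R : realType} {k : nat} (w : 'rV[R]_k) (i : 'I_k) :
  `|w 0 i| <= `|w|.
Proof.
rewrite [leRHS]/Num.norm/= mx_normrE; apply/bigmax_geP; right.
by exists (0, i).
Qed.

Section SmoothFunctions.
Context {R : realType} {k : nat} {U : set 'rV[R]_k}.
Implicit Types (f : 'rV[R]_k -> R) (z h v w : 'rV[R]_k).

Lemma C_on_continuous r f z : C_on r U f -> U z -> {for z, continuous f}.
Proof. by case: r => [|r] [cf _]; exact: cf. Qed.

Lemma C_on_derivable r f z h : C_on r.+1 U f -> U z -> derivable f z h.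
Proof. by move=> [_ /(_ h)[df _]]; exact: df. Qed.

Lemma C_on_D r f h : C_on r.+1 U f -> C_on r U ('D_h f).
Proof. by move=> [_ /(_ h)[]]. Qed.

Lemma C_onW r f : C_on r.+1 U f -> C_on r U f.
Proof.
elim: r f => [|r IH] f fC; first by split=> // z; exact: C_on_continuous fC.
split=> [z|h]; first exact: C_on_continuous fC.
by split=> [z Uz|]; [exact: C_on_derivable fC Uz | exact: IH (C_on_D _ _ _ fC)].
Qed.

Hypothesis Uopen : open U.

Lemma open_shift z : U z -> exists2 d : R, 0 < d & forall w, `|w| < d -> U (z + w).
Proof. by move=> Uz; apply: nbhs_shift; exact: open_nbhs_nbhs. Qed.

Lemma continuous_shift f z : U z -> {for z, continuous f} ->
  forall e : R, 0 < e -> exists2 d : R, 0 < d &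
    forall w, `|w| < d -> U (z + w) /\ `|f (z + w) - f z| <= e.
Proof.
move=> Uz /cvgrPdistC_le cf e e0.
have [d d0 dP] := nbhs_shift _ _ (cf e e0); have [b b0 bP] := open_shift _ Uz.
by exists (Num.min d b) => [|w]; rewrite lt_min ?d0// => /andP[/dP ? /bP].
Qed.

Lemma norm_lt_scale v (d : R) : 0 < d ->
  exists2 b : R, 0 < b & forall s, `|s| < b -> `|s *: v| < d.
Proof.
move=> d0; have v1 : 0 < `|v| + 1 by rewrite ltr_wpDl.
exists (d / (`|v| + 1)); first exact: divr_gt0.
move=> s; rewrite ltr_pdivlMr// normrZ => /le_lt_trans; apply.
by rewrite ler_wpM2l// lerDl.
Qed.

(** The increment along [v + h] splits into one along [v] from [z] and one along [h] from the moved
    point; the mean value theorem and continuity of ['D_h f] bring the second back to [z]. *)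
Lemma deriveD_dir f z v h : C_on 1 U f -> U z ->
  is_derive z (v + h) f ('D_v f z + 'D_h f z).
Proof.
move=> f1 Uz; apply/is_deriveP => e e0.
have e2 : 0 < e / 2 by rewrite divr_gt0.
have [b b0 bP] := continuous_shift _ _ Uz
  (C_on_continuous _ _ _ (C_on_D _ _ h f1) Uz) _ e2.
have [d d0 dP] := (is_deriveP f z v _).1
  (derivableP (C_on_derivable _ _ _ v f1 Uz)) _ e2.
have b2 : 0 < b / 2 by rewrite divr_gt0.
have [dv dv0 vP] := norm_lt_scale v _ b2.
have [dh dh0 hP] := norm_lt_scale h _ b2.
exists (Num.min d (Num.min dv dh)); first by rewrite !lt_min d0 dv0.
move=> t; rewrite !lt_min => /and3P[td tv th].
have small (s : R) : 0 <= s <= 1 -> `|t *: v + s *: (t *: h)| < b.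
  move=> /andP[s0 s1]; rewrite (le_lt_trans (ler_normD _ _))//.
  rewrite [b]splitr ltrD ?vP// (le_lt_trans _ (hP t th))// normrZ.
  by rewrite ler_piMl// ger0_norm.
have [s s01 sE] : exists2 s, 0 < s < 1 & f (z + t *: v + t *: h) - f (z + t *: v)
    = 'D_(t *: h) f (z + t *: v + s *: (t *: h)).
  apply: MVT_line => s s01.
  rewrite -addrA; apply: ex_derive; apply: is_deriveZ_dir.
  by apply: (C_on_derivable _ _ _ _ f1); exact: (bP _ (small s s01)).1.
have s01' : 0 <= s <= 1 by case/andP: s01 => ? ?; rewrite !ltW.
have [Us sb] := bP _ (small s s01').
rewrite scalerDr addrA.
have -> : f (z + t *: v + t *: h) - f z - t * ('D_v f z + 'D_h f z) =
  (f (z + t *: v) - f z - t * 'D_v f z) +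
  t * ('D_h f (z + (t *: v + s *: (t *: h))) - 'D_h f z).
  have dZ : 'D_(t *: h) f (z + (t *: v + s *: (t *: h))) =
     t * 'D_h f (z + (t *: v + s *: (t *: h))).
    apply: derive_val; apply: is_deriveZ_dir.
    exact: (C_on_derivable _ _ _ _ f1).
  rewrite -[X in 'D_ _ f X]addrA dZ in sE; rewrite mulrBr -sE; ring.
rewrite (le_trans (ler_normD _ _))// [e]splitr mulrDl lerD ?dP//.
by rewrite normrM mulrC ler_wpM2r.
Qed.

Lemma derive_linear_dir r f z (a : R) v h : C_on r.+1 U f -> U z ->
  'D_(a *: v + h) f z = a * 'D_v f z + 'D_h f z.
Proof.
move=> fC Uz; have f1 : C_on 1 U f.
  split=> [x Ux|w]; first exact: C_on_continuous fC Ux.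
  split=> [x Ux|]; first exact: C_on_derivable fC Ux.
  by split=> // x Ux; exact: (C_on_continuous r _ _ (C_on_D _ _ _ fC)).
rewrite (derive_val (is_derive := deriveD_dir _ _ (a *: v) h f1 Uz)).
congr (_ + _); apply: derive_val; apply: is_deriveZ_dir.
exact: C_on_derivable f1 Uz.
Qed.

Lemma derive2_linear_dir r f z (a : R) v h w : C_on r.+2 U f -> U z ->
  'D_w ('D_(a *: v + h) f) z = a * 'D_w ('D_v f) z + 'D_w ('D_h f) z.
Proof.
move=> fC Uz.
have dv : is_derive z w (fun x => a * 'D_v f x) (a * 'D_w ('D_v f) z).
  have dv : derivable ('D_v f) z w.
    exact: C_on_derivable (C_on_D _ _ _ fC) Uz.
  exact: is_deriveZ.
have dh : derivable ('D_h f) z w.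
  exact: C_on_derivable (C_on_D _ _ _ fC) Uz.
rewrite -[RHS](derive_val (is_derive := is_deriveD dv (derivableP dh))).
apply: near_eq_derive; near=> x; apply: derive_linear_dir fC _.
by near: x; apply: open_nbhs_nbhs; split.
Unshelve. all: by end_near. Qed.

Lemma MVT_in f z v : C_on 1 U f ->
  (forall s, 0 <= s <= 1 -> U (z + s *: v)) ->
  exists2 s, 0 < s < 1 & f (z + v) - f z = 'D_v f (z + s *: v).
Proof.
move=> f1 Us; apply: MVT_line => s s01.
by apply: C_on_derivable f1 (Us _ s01).
Qed.

(* Both mixed derivatives are values, at nearby points, of the same second
   difference of f divided by [t ^ 2]. *)
Lemma derive_sym f z v h : C_on 2 U f -> U z ->
  'D_v ('D_h f) z = 'D_h ('D_v f) z.
Proof.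
move=> f2 Uz.
have f1 := C_onW _ _ f2.
suff key v' h' (e : R) : 0 < e -> exists2 d : R, 0 < d & forall t, 0 < t < d ->
    `|f (z + t *: v' + t *: h') - f (z + t *: v') - (f (z + t *: h') - f z)
      - t ^+ 2 * 'D_h' ('D_v' f) z| <= e * t ^+ 2.
  apply/eqP; rewrite -subr_eq0 -normr_le0; apply/ler_addgt0Pr => e e0.
  rewrite add0r; have e2 : 0 < e / 2 by rewrite divr_gt0.
  have [d d0 dP] := key v h _ e2; have [b b0 bP] := key h v _ e2.
  pose t := Num.min d b / 2.
  have t0 : 0 < t by rewrite divr_gt0// lt_min d0.
  have td : t < d by rewrite ltr_pdivrMr// gt_min; lra.
  have tb : t < b by rewrite ltr_pdivrMr// gt_min; lra.
  have {dP} := dP t; rewrite t0 td => /(_ isT) Hd.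
  have {bP} := bP t; rewrite t0 tb => /(_ isT) Hb.
  have t2 : 0 < t ^+ 2 by rewrite exprn_gt0.
  rewrite -(ler_pM2r t2) -(gtr0_norm t2) -normrM (gtr0_norm t2).
  rewrite [leRHS](_ : _ = e / 2 * t ^+ 2 + e / 2 * t ^+ 2); last by field.
  apply: le_trans (lerD Hd Hb).
  apply: le_trans (ler_normB _ _); rewrite le_eqVlt; apply/orP; left.
  apply/eqP; congr (`| _ |).
  rewrite [z + t *: v + _]addrAC.
  move: ('D_v _ z) ('D_h _ z) (f _) (f _) (f _) (f _) => *; ring.
move=> e0.
have [b b0 bP] := continuous_shift _ _ Uz
  (C_on_continuous _ _ _ (C_on_D _ _ h' (C_on_D _ _ v' f2)) Uz) _ e0.
have b2 : 0 < b / 2 by rewrite divr_gt0.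
have [dv dv0 vP] := norm_lt_scale v' _ b2.
have [dh dh0 hP] := norm_lt_scale h' _ b2.
exists (Num.min dv dh); first by rewrite lt_min dv0.
move=> t /andP[t0]; rewrite lt_min => /andP[tv th].
have small (s r : R) : 0 <= s <= 1 -> 0 <= r <= 1 ->
    `|s *: (t *: v') + r *: (t *: h')| < b.
  move=> /andP[s0 s1] /andP[r0 r1]; rewrite (le_lt_trans (ler_normD _ _))//.
  have tE : `|t| = t by rewrite gtr0_norm.
  rewrite [b]splitr ltrD//.
    rewrite (le_lt_trans _ (vP t _)) ?tE// normrZ.
    by rewrite ler_piMl// ger0_norm.
  rewrite (le_lt_trans _ (hP t _)) ?tE// normrZ.
  by rewrite ler_piMl// ger0_norm.
have inU (s r : R) : 0 <= s <= 1 -> 0 <= r <= 1 ->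
    U (z + s *: (t *: v') + r *: (t *: h')).
  by move=> s01 r01; rewrite -addrA; exact: (bP _ (small s r s01 r01)).1.
have d1 (s r : R) : 0 <= s <= 1 -> 0 <= r <= 1 ->
    is_derive (z + s *: (t *: v') + r *: (t *: h')) (t *: v') f
      (t * 'D_v' f (z + s *: (t *: v') + r *: (t *: h'))).
  by move=> s01 r01; apply: is_deriveZ_dir; apply: C_on_derivable f1 (inU _ _ _ _).
have b01 : 0 <= (0 : R) <= 1 /\ 0 <= (1 : R) <= 1 by rewrite !lexx ler01.
have d2 (s : R) : 0 <= s <= 1 ->
    is_derive s (1 : R) (fun s => f (z + t *: h' + s *: (t *: v')) - f (z + s
      *: (t *: v')))
      (t * ('D_v' f (z + s *: (t *: v') + t *: h') - 'D_v' f (z + s *: (t *: v')))).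
  move=> s01; rewrite mulrBr.
  have := d1 s 1 s01 b01.2; rewrite scale1r addrAC => -[e1 <-].
  have := d1 s 0 s01 b01.1; rewrite scale0r addr0 => -[e2 <-].
  exact: (is_deriveB (is_derive_line _ _ _ _ e1) (is_derive_line _ _ _ _ e2)).
have [s s01] := MVT_cc _ _ 0 1 ltr01 d2.
have {}s01 : 0 <= s <= 1 by case/andP: s01 => ? ?; rewrite !ltW.
have dr (r : R) : 0 <= r <= 1 -> derivable ('D_v' f)
    (z + s *: (t *: v') + r *: (t *: h')) (t *: h').
  by move=> r01; exact: C_on_derivable (C_on_D _ _ v' f2) (inU _ _ s01 r01).
have [r r01 ->] := MVT_line ('D_v' f) (z + s *: (t *: v')) (t *: h') dr.
have {}r01 : 0 <= r <= 1 by case/andP: r01 => ? ?; rewrite !ltW.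
rewrite (derive_val (is_derive := is_deriveZ_dir _ _ _ _
  (C_on_derivable _ _ _ _ (C_on_D _ _ v' f2) (inU s r s01 r01)))).
rewrite !scale1r !scale0r !addr0 subr0 mulr1 mulrA -expr2.
rewrite [z + t *: h' + _]addrAC => ->; rewrite -mulrBr normrM mulrC.
rewrite (gtr0_norm (exprn_gt0 2 t0)) ler_wpM2r ?exprn_ge0 ?(ltW t0)//.
by rewrite -addrA (bP _ (small s r s01 r01)).2.
Qed.

(* The i-th partial derivatives are close to those at z on the whole segment,
   and a direction is a combination of the basis vectors. *)
Lemma C1_strict_differentiable f z : C_on 1 U f -> U z ->
  forall e : R, 0 < e -> exists2 d : R, 0 < d & forall w, `|w| < d ->
    `|f (z + w) - f z - 'D_w f z| <= e * `|w|.
Proof.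
move=> f1 Uz e e0.
have lin x w : U x -> 'D_w f x = \sum_(i < k) w 0 i * 'D_(delta_mx 0 i) f x.
  move=> Ux; rewrite {1}[w]row_sum_delta.
  have D0 : 'D_0 f x = 0 by exact: derive0.
  elim/big_rec2 : _ => // i y1 y2 _ IH.
  by rewrite (derive_linear_dir _ _ _ _ _ _ f1)// IH.
pose e' := e / (k%:R + 1).
have e'0 : 0 < e' by rewrite divr_gt0// ltr_wpDl// ler0n.
have [d d0 dP] : exists2 d : R, 0 < d & forall w, `|w| < d -> U (z + w) /\
    forall i, `|'D_(delta_mx 0 i) f (z + w) - 'D_(delta_mx 0 i) f z| <= e'.
  have H i := continuous_shift _ _ Uz
    (C_on_continuous _ _ _ (C_on_D _ _ (delta_mx 0 i) f1) Uz) _ e'0.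
  have [b b0 bP] := open_shift _ Uz.
  pose g i := sval (cid2 (H i)).
  have gP i : 0 < g i /\ forall w, `|w| < g i ->
     `|'D_(delta_mx 0 i) f (z + w) - 'D_(delta_mx 0 i) f z| <= e'.
    by rewrite /g; case: cid2 => /= x x0 xP; split=> // w /xP[].
  exists (\big[Num.min/b]_(i < k) g i).
    by apply: lt_bigmin => // i _; exact: (gP i).1.
  move=> w /bigmin_gtP[/bP Uw wg]; split=> // i.
  by apply: (gP i).2; exact: wg.
exists d => // w wd.
have small (s : R) : 0 <= s <= 1 -> `|s *: w| < d.
  move=> /andP[s0 s1]; rewrite (le_lt_trans _ wd)// normrZ.
  by rewrite ler_piMl// ger0_norm.
have [s s01 ->] := MVT_in _ _ _ f1 (fun s s01 => (dP _ (small s s01)).1).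
have {}s01 : 0 <= s <= 1 by case/andP: s01 => ? ?; rewrite !ltW.
have [Us Ds] := dP _ (small s s01).
rewrite !lin// -sumrB.
apply: (@le_trans _ _ (\sum_(i < k) `|w| * e')).
  apply: (le_trans (ler_norm_sum _ _ _)); apply: ler_sum => i _.
  by rewrite -mulrBr normrM ler_pM ?norm_entry.
rewrite sumr_const card_ord -mulr_natl mulrCA mulrC ler_wpM2r//.
by rewrite /e' mulrCA ler_piMr ?ltW// ltr_pdivrMr ?ltr_wpDl ?ler0n// mul1r ltrDl.
Qed.
End SmoothFunctions.

(** * Self-concordance along a line *)

(** The self-concordance inequality says exactly that [psi] to the power -1/2 has derivative of
    absolute value at most 1. Adding [e] keeps the inverse square root defined where [psi]
    vanishes. *)
Lemma sqrt_growth_eps {R : realType} (psi dpsi : R -> R) (b e : R) : 0 < e ->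
  (forall t, 0 <= t <= b -> is_derive t 1 psi (dpsi t)) ->
  (forall t, 0 <= t <= b -> 0 <= psi t) ->
  (forall t, 0 <= t <= b -> `|dpsi t| <= 2 * Num.sqrt (psi t) ^+ 3) ->
  forall s t, 0 <= s <= b -> 0 <= t <= b ->
  (Num.sqrt (psi s + e))^-1 - (Num.sqrt (psi t + e))^-1 <= `|t - s|.
Proof.
move=> e0 dp p0 dpb.
have pe t : 0 <= t <= b -> 0 < psi t + e by move=> tb; rewrite ltr_wpDl// p0.
pose g t := (Num.sqrt (psi t + e))^-1.
pose dg t := - (Num.sqrt (psi t + e))^-2 *: ((2 * Num.sqrt (psi t + e))^-1 * dpsi t).
have gd t : 0 <= t <= b -> is_derive t 1 g (dg t).
  move=> tb; rewrite /g /dg.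
  have s0 : Num.sqrt (psi t + e) != 0 by rewrite gt_eqF// sqrtr_gt0 pe.
  apply: is_deriveV => //.
  have d1 := is_derive1_sqrt (pe t tb).
  have d2 : is_derive t 1 (fun x => psi x + e) (dpsi t).
    have := is_deriveD (dp t tb) (is_derive_cst e t 1).
    by rewrite addr0.
  exact: (@is_derive1_comp R Num.sqrt (fun x => psi x + e) t _ _ d1 d2).
have dgb t : 0 <= t <= b -> `|dg t| <= 1.
  move=> tb; rewrite /dg; have := dpb t tb.
  have := pe t tb; have := p0 t tb; move: (psi t) (dpsi t) => p q p0' pe'.
  have a0 : 0 < Num.sqrt (p + e) by rewrite sqrtr_gt0.
  have ap : Num.sqrt p <= Num.sqrt (p + e) by rewrite ler_wsqrtr// lerDl ltW.
  have ap3 : Num.sqrt p ^+ 3 <= Num.sqrt (p + e) ^+ 3.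
    by rewrite lerXn2r ?nnegrE ?sqrtr_ge0.
  move=> /le_trans/(_ (ler_wpM2l (ler0n _ 2) ap3)) {ap ap3}.
  move: (Num.sqrt (p + e)) a0 => a a0 qa.
  rewrite normrZ normrN normrM !normfV normrX normrM (gtr0_norm a0) normr_nat.
  rewrite mulrA -invfM ler_pdivrMl ?mulr_gt0 ?exprn_gt0// mulr1.
  by apply: le_trans qa _; rewrite le_eqVlt; apply/orP; left; apply/eqP; ring.
have mvt s t : 0 <= s -> s < t -> t <= b -> `|g t - g s| <= t - s.
  move=> s0 st tb.
  have [y syt|x /andP[sx xt] ->] := MVT_cc g dg s t st.
    case/andP: syt => sy yt; apply: gd.
    by rewrite (le_trans s0 sy) (le_trans yt tb).
  rewrite normrM [`|t - s|]ger0_norm ?subr_ge0 ?(ltW st)//.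
  rewrite ler_piMl ?subr_ge0 ?(ltW st)// dgb//.
  by rewrite (le_trans s0 (ltW sx)) (le_trans (ltW xt) tb).
move=> s t /andP[s0 sb] /andP[t0 tb].
apply: (le_trans (ler_norm _)); rewrite -/(g s) -/(g t).
have [st|ts|->] := ltgtP s t.
- rewrite distrC (le_trans (mvt _ _ s0 st tb))// ler_norm//.
- by rewrite (le_trans (mvt _ _ t0 ts sb))// distrC ler_norm.
- by rewrite !subrr.
Qed.

(** The limit [e] to 0 of the regularized estimate, multiplied out so that it stays meaningful when
    [psi] vanishes. *)
Lemma sqrt_growth {R : realType} (psi dpsi : R -> R) (b : R) :
  (forall t, 0 <= t <= b -> is_derive t 1 psi (dpsi t)) ->
  (forall t, 0 <= t <= b -> 0 <= psi t) ->
  (forall t, 0 <= t <= b -> `|dpsi t| <= 2 * Num.sqrt (psi t) ^+ 3) ->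
  forall s t, 0 <= s <= b -> 0 <= t <= b ->
  Num.sqrt (psi t) * (1 - `|t - s| * Num.sqrt (psi s)) <= Num.sqrt (psi s).
Proof.
move=> dp p0 dpb s t sb tb.
have H (e : R) : 0 < e -> Num.sqrt (psi t) - (Num.sqrt (psi s) + e) <=
   `|t - s| * ((Num.sqrt (psi t) + e) * (Num.sqrt (psi s) + e)).
  move=> e0; have e2 : 0 < e ^+ 2 by rewrite exprn_gt0.
  have := @sqrt_growth_eps _ _ _ b _ e2 dp p0 dpb s t sb tb.
  have rt x : 0 <= x -> [/\ 0 < Num.sqrt (x + e ^+ 2),
     Num.sqrt x <= Num.sqrt (x + e ^+ 2) & Num.sqrt (x + e ^+ 2) <= Num.sqrt x + e].
    move=> x0; split.
    - by rewrite sqrtr_gt0 ltr_wpDl.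
    - by rewrite ler_wsqrtr// lerDl ltW.
    - rewrite -(@ler_pXn2r _ 2) ?nnegrE ?sqrtr_ge0 ?addr_ge0 ?sqrtr_ge0 ?(ltW e0)//.
      rewrite sqr_sqrtr ?addr_ge0 ?(ltW e2)// sqrrD sqr_sqrtr// -addrA lerD2l.
      by rewrite lerDr mulrn_wge0// mulr_ge0 ?sqrtr_ge0 ?(ltW e0).
  have [] := rt _ (p0 s sb); have [] := rt _ (p0 t tb).
  have := normr_ge0 (t - s); have := sqrtr_ge0 (psi t); have := sqrtr_ge0 (psi s).
  move: (Num.sqrt (psi s)) (Num.sqrt (psi t)) (Num.sqrt (psi s + _)) (Num.sqrt
    (psi t + _)).
  move: `|t - s| => d S T Se Te S0 T0 d0 Te0 TTe TeT Se0 SSe SeS.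
  have -> : Se^-1 - Te^-1 = (Te - Se) / (Te * Se) by field; rewrite !gt_eqF.
  rewrite ler_pdivrMr ?mulr_gt0// => Hd.
  have : d * (Te * Se) <= d * ((T + e) * (S + e)).
    by apply: ler_wpM2l => //; apply: ler_pM => //; exact: ltW.
  lra.
move: (normr_ge0 (t - s)) (sqrtr_ge0 (psi t)) (sqrtr_ge0 (psi s)) H.
move: (Num.sqrt (psi s)) (Num.sqrt (psi t)) `|t - s| => S T d d0 T0 S0 H.
rewrite mulrBr mulr1 lerBlDr; apply/ler_addgt0Pr => e e0.
(* With a regularization at most 1, so that its square is below it, the total error in [H] is at
   most the regularization times [c]. *)
pose c := 1 + d * (T + S + 1).
have c1 : 1 <= c by rewrite lerDl mulr_ge0// !addr_ge0.
pose e' := Num.min 1 (e / c).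
have e'0 : 0 < e' by rewrite lt_min ltr01 divr_gt0// (lt_le_trans ltr01).
have e'1 : e' <= 1 by rewrite ge_min lexx.
have e'c : e' * c <= e.
  by rewrite -ler_pdivlMr ?(lt_le_trans ltr01 c1)// ge_min lexx orbT.
have := H _ e'0; have : d * (e' * e') <= d * e'.
  by rewrite ler_wpM2l// ler_piMl// ltW.
move: e'c; rewrite /c; move: e' e'0 e'1 => x x0 x1; nra.
Qed.

Lemma ndecr_cc {R : realType} (f df : R -> R) (a b : R) : a <= b ->
  (forall x, a <= x <= b -> is_derive x 1 f (df x)) ->
  (forall x, a <= x <= b -> 0 <= df x) -> f a <= f b.
Proof.
rewrite le_eqVlt => /predU1P[->//|ab] fdf df0.
have [c /andP[ac cb] fE] := MVT_cc f df a b ab fdf.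
rewrite -subr_ge0 fE mulr_ge0 ?subr_ge0 ?(ltW ab)// df0//.
by rewrite !ltW.
Qed.

Section SelfConcordantLine.
Context {R : realType} (phi psi dpsi : R -> R) (b : R).
Hypothesis b0 : 0 <= b.
Hypothesis dphi : forall t, 0 <= t <= b -> is_derive t 1 phi (psi t).
Hypothesis dp : forall t, 0 <= t <= b -> is_derive t 1 psi (dpsi t).
Hypothesis p0 : forall t, 0 <= t <= b -> 0 <= psi t.
Hypothesis dpb :
  forall t, 0 <= t <= b -> `|dpsi t| <= 2 * Num.sqrt (psi t) ^+ 3.
Let r := Num.sqrt (psi 0).
Let r0 : 0 <= r. Proof. exact: sqrtr_ge0. Qed.
Let O0b : 0 <= (0 : R) <= b. Proof. by rewrite lexx. Qed.

Lemma sqrt_psi_le t : 0 <= t <= b -> Num.sqrt (psi t) * (1 - t * r) <= r.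
Proof.
move=> tb; have := @sqrt_growth _ _ _ b dp p0 dpb _ _ O0b tb.
by rewrite subr0 ger0_norm//; case/andP: tb.
Qed.

Lemma sqrt_psi_ge t : 0 <= t <= b -> r <= Num.sqrt (psi t) * (1 + t * r).
Proof.
move=> tb; have := @sqrt_growth _ _ _ b dp p0 dpb _ _ tb O0b.
rewrite -/r sub0r normrN ger0_norm; last by case/andP: tb.
by move: (Num.sqrt (psi t)) => a H; lra.
Qed.

(** Comparison with r - r / (1 + x r), whose derivative r^2 / (1 + x r)^2 is a lower bound of [psi]
    by [sqrt_psi_ge]. *)
Lemma phi_growth t : 0 <= t <= b ->
  r ^+ 2 * t <= (phi t - phi 0) * (1 + t * r).
Proof.
move=> /andP[t0 tb].
have P x : 0 <= x -> 0 < 1 + x * r by move=> x0; rewrite ltr_pwDl// mulr_ge0.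
pose g (x : R) := phi x - (r - r / (1 + x * r)).
pose dg x := psi x - r ^+ 2 / (1 + x * r) ^+ 2.
have gd x : 0 <= x <= t -> is_derive x 1 g (dg x).
  move=> /andP[x0 xt]; rewrite /g /dg.
  have P0 : 1 + x * r != 0 by rewrite gt_eqF// P.
  have d1 : is_derive x 1 (fun x => 1 + x * r) r.
    apply/is_deriveP => e e0; exists 1 => // s _.
    rewrite [X in `|X|](_ : _ = 0) ?normr0 ?mulr_ge0 ?(ltW e0)//.
    by rewrite /= [s *: 1]mulr1; ring.
  have d2 := @is_deriveV R (fun x => 1 + x * r) x _ _ P0 d1.
  have d3 := is_deriveZ r d2.
  have d4 := is_deriveB (is_derive_cst r x 1) d3.
  have xb : 0 <= x <= b by rewrite x0 (le_trans xt tb).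
  apply: (is_derive_eq (is_deriveB (dphi x xb) d4)).
  by rewrite sub0r opprK /GRing.scale/=; field.
have := @ndecr_cc _ g dg 0 t t0 gd.
have dg0 x : 0 <= x <= t -> 0 <= dg x.
  move=> /andP[x0 xt]; have xb : 0 <= x <= b by rewrite x0 (le_trans xt).
  rewrite subr_ge0 -expr_div_n -[leRHS]sqr_sqrtr ?p0//.
  rewrite lerXn2r ?nnegrE ?sqrtr_ge0 ?divr_ge0 ?(ltW (P x x0))//.
  by rewrite ler_pdivrMr ?P// sqrt_psi_ge.
move=> /(_ dg0); rewrite /g mul0r addr0 divr1 subrr subr0.
rewrite -lerBlDl opprB => H.
have -> : r ^+ 2 * t = (r - r / (1 + t * r)) * (1 + t * r).
  by rewrite mulrBl divfK ?gt_eqF ?P//; ring.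
by rewrite ler_pM2r ?P//; lra.
Qed.

End SelfConcordantLine.

(** * Euclidean structure, gradient and Hessian *)

Section Dot.
Context {R : realType}.
Implicit Types k : nat.

Lemma dotE {k : nat} (u v : 'rV[R]_k) : dot u v = \sum_i u 0 i * v 0 i.
Proof. by rewrite /dot mxE; apply: eq_bigr => i _; rewrite mxE. Qed.

Lemma dotC {k : nat} (u v : 'rV[R]_k) : dot u v = dot v u.
Proof. by rewrite !dotE; apply: eq_bigr => i _; rewrite mulrC. Qed.

Lemma dotDl {k : nat} (u v w : 'rV[R]_k) : dot (u + v) w = dot u w + dot v w.
Proof. by rewrite /dot mulmxDl mxE. Qed.

Lemma dotDr {k : nat} (u v w : 'rV[R]_k) : dot w (u + v) = dot w u + dot w v.
Proof. by rewrite !(dotC w) dotDl. Qed.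

Lemma dotZl {k : nat} a (u v : 'rV[R]_k) : dot (a *: u) v = a * dot u v.
Proof. by rewrite /dot -scalemxAl mxE. Qed.

Lemma dotZr {k : nat} a (u v : 'rV[R]_k) : dot v (a *: u) = a * dot v u.
Proof. by rewrite !(dotC v) dotZl. Qed.

Lemma dotNl {k : nat} (u v : 'rV[R]_k) : dot (- u) v = - dot u v.
Proof. by rewrite -scaleN1r dotZl mulN1r. Qed.

Lemma dotNr {k : nat} (u v : 'rV[R]_k) : dot v (- u) = - dot v u.
Proof. by rewrite -scaleN1r dotZr mulN1r. Qed.

Lemma dotBl {k : nat} (u v w : 'rV[R]_k) : dot (u - v) w = dot u w - dot v w.
Proof. by rewrite dotDl dotNl. Qed.

Lemma dotBr {k : nat} (u v w : 'rV[R]_k) : dot w (u - v) = dot w u - dot w v.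
Proof. by rewrite dotDr dotNr. Qed.

Lemma dot0l {k : nat} (v : 'rV[R]_k) : dot 0 v = 0.
Proof. by rewrite -(scale0r 0) dotZl mul0r. Qed.

Lemma dot0r {k : nat} (v : 'rV[R]_k) : dot v 0 = 0.
Proof. by rewrite dotC dot0l. Qed.

Lemma dot_mulmx {k l : nat} (A : 'M[R]_(k, l)) (x : 'rV[R]_k) (y : 'rV[R]_l) :
  dot (x *m A) y = dot x (y *m A^T).
Proof. by rewrite /dot trmx_mul trmxK mulmxA. Qed.

Lemma dot_delta {k : nat} (v : 'rV[R]_k) (i : 'I_k) : dot v (delta_mx 0 i) = v 0 i.
Proof.
rewrite dotE (bigD1 i)//= mxE !eqxx mulr1 big1 ?addr0// => j ji.
by rewrite mxE eqxx/= (negbTE ji) mulr0.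
Qed.

Lemma dot_ge0 {k : nat} (v : 'rV[R]_k) : 0 <= dot v v.
Proof. by rewrite dotE sumr_ge0// => i _; rewrite -expr2 sqr_ge0. Qed.

Lemma norm_le_enorm {k : nat} (v : 'rV[R]_k) : `|v| <= enorm v.
Proof.
rewrite [leLHS]/Num.norm/= mx_normrE; apply: bigmax_le; first exact: sqrtr_ge0.
move=> [i j] _ /=; rewrite ord1 /enorm -sqrtr_sqr ler_wsqrtr// dotE.
by rewrite (bigD1 j)//= -expr2 lerDl sumr_ge0// => l _; rewrite -expr2 sqr_ge0.
Qed.

Lemma enorm_ge0 {k : nat} (v : 'rV[R]_k) : 0 <= enorm v.
Proof. exact: sqrtr_ge0. Qed.

Lemma enorm_sqr {k : nat} (v : 'rV[R]_k) : enorm v ^+ 2 = dot v v.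
Proof. by rewrite sqr_sqrtr// dot_ge0. Qed.

Lemma enorm_eq0 {k : nat} (v : 'rV[R]_k) : enorm v = 0 -> v = 0.
Proof.
by move=> v0; apply/eqP; rewrite -normr_le0 -v0 norm_le_enorm.
Qed.

(* Applied to [t |-> B (u + t v)] this is the Cauchy-Schwarz inequality of a
   semidefinite symmetric form B. *)
Lemma sqr_le_of_quadratic (a b c : R) : 0 <= c ->
  (forall t, 0 <= a + 2 * t * b + t ^+ 2 * c) -> b ^+ 2 <= a * c.
Proof.
rewrite le_eqVlt => /predU1P[<- H|c0 H].
  rewrite mulr0; have [->|b0] := eqVneq b 0; first by rewrite expr0n.
  have := H (- (a + 1) / (2 * b)).
  have -> : a + 2 * (- (a + 1) / (2 * b)) * b + (- (a + 1) / (2 * b)) ^+ 2 * 0 = - 1.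
    by field.
  by rewrite oppr_ge0 ler10.
have := H (- b / c).
have -> : a + 2 * (- b / c) * b + (- b / c) ^+ 2 * c = (a * c - b ^+ 2) / c.
  by field; rewrite gt_eqF.
by rewrite pmulr_lge0 ?invr_gt0// subr_ge0.
Qed.

Lemma norm_le_of_quadratic (a b c : R) : 0 <= a -> 0 <= c ->
  (forall t, 0 <= a + 2 * t * b + t ^+ 2 * c) ->
  `|b| <= Num.sqrt a * Num.sqrt c.
Proof.
move=> a0 c0 H; rewrite -sqrtrM// -sqrtr_sqr ler_wsqrtr//.
exact: sqr_le_of_quadratic.
Qed.

Lemma dot_cauchy {k : nat} (u v : 'rV[R]_k) : `|dot u v| <= enorm u * enorm v.
Proof.
apply: norm_le_of_quadratic => [||t]; rewrite ?dot_ge0//.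
have := dot_ge0 (u + t *: v).
by rewrite dotDl !dotDr !dotZl !dotZr (dotC v u) => H; lra.
Qed.

Lemma enorm_triangle {k : nat} (u v : 'rV[R]_k) : enorm (u + v) <= enorm u + enorm v.
Proof.
rewrite -(@ler_pXn2r _ 2) ?nnegrE ?addr_ge0 ?enorm_ge0//.
rewrite sqrrD !enorm_sqr dotDl !dotDr (dotC v u).
by have := le_trans (ler_norm _) (dot_cauchy u v); lra.
Qed.

Lemma enormN {k : nat} (u : 'rV[R]_k) : enorm (- u) = enorm u.
Proof. by rewrite /enorm dotNl dotNr opprK. Qed.

Lemma enormZ {k : nat} a (u : 'rV[R]_k) : enorm (a *: u) = `|a| * enorm u.
Proof.
by rewrite /enorm dotZl dotZr mulrA -expr2 sqrtrM ?sqr_ge0// sqrtr_sqr.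
Qed.

End Dot.

Section Hessian.
Context {R : realType} {k : nat} {U : set 'rV[R]_k}.
Hypothesis Uopen : open U.
Implicit Types (f : 'rV[R]_k -> R) (z h v w : 'rV[R]_k).

Lemma derive_gradE r f z h : C_on r.+1 U f -> U z ->
  'D_h f z = dot (grad f z) h.
Proof.
move=> fC Uz; rewrite dotE {1}[h]row_sum_delta.
have D0 : 'D_0 f z = 0 by exact: derive0.
elim/big_rec2 : _ => // i y1 y2 _ IH.
by rewrite (derive_linear_dir Uopen _ _ _ _ _ _ fC)// IH mxE mulrC.
Qed.

Lemma derive2_hessE f z v h : C_on 2 U f -> U z ->
  'D_v ('D_h f) z = dot (h *m hess f z) v.
Proof.
move=> fC Uz.
have -> : dot (h *m hess f z) v = \sum_i h 0 i * 'D_v ('D_(delta_mx 0 i) f) z.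
  rewrite /dot -mulmxA mxE; apply: eq_bigr => i _; congr (_ * _).
  rewrite (derive_gradE 0 _ _ _ (C_on_D _ _ _ fC) Uz) dotE mxE.
  by apply: eq_bigr => j _; rewrite !mxE.
rewrite {1}[h]row_sum_delta.
have D0 : 'D_v ('D_0 f) z = 0.
  by rewrite (derive_sym Uopen _ _ _ _ fC Uz); exact: derive0.
elim/big_rec2 : _ => // i y1 y2 _ IH.
by rewrite (derive2_linear_dir Uopen _ _ _ _ _ _ _ fC)// IH.
Qed.

Lemma hess_sym f z : C_on 2 U f -> U z -> (hess f z)^T = hess f z.
Proof. by move=> fC Uz; apply/matrixP => i j; rewrite !mxE (derive_sym Uopen _
  _ _ _ fC Uz). Qed.

End Hessian.

(** * Convex domains, recession directions and their polar cone *)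

Lemma nbhs_of_shift {R : realType} {V : normedModType R} (z : V) (P : set V)
    (d : R) : 0 < d -> (forall w, `|w| < d -> P (z + w)) -> nbhs z P.
Proof.
move=> d0 dP; apply/nbhs_ballP; exists d => //= w.
rewrite -ball_normE/= -normrN opprB => /dP; by rewrite addrCA subrr addr0.
Qed.

Lemma closed_approx {R : realType} {V : normedModType R} (D : set V) (x : V) :
  closed D -> (forall e : R, 0 < e -> exists2 p, D p & `|p - x| < e) -> D x.
Proof.
move=> Dcl H; apply: Dcl => B /nbhs_ballP[e /= e0 eB].
have [p Dp pe] := H e e0; exists p; split => //; apply: eB.
by rewrite -ball_normE/= distrC.
Qed.

Lemma continuous_of_shift {R : realType} {V : normedModType R} (f : V -> R)
    (z : V) :
  (forall e : R, 0 < e -> exists2 d : R, 0 < d &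
     forall w, `|w| < d -> `|f (z + w) - f z| <= e) ->
  {for z, continuous f}.
Proof.
move=> H; apply/cvgrPdistC_le => e /H[d d0 dP].
exact: (nbhs_of_shift _ _ _ d0).
Qed.

Section ConvexDomain.
Context {R : realType} {m : nat} {D : set 'rV[R]_m}.
Implicit Types (x y z h w : 'rV[R]_m).

Lemma interior_shift z : D° z -> exists2 d : R, 0 < d &
  forall w, `|w| < d -> D (z + w).
Proof. exact: nbhs_shift. Qed.

Lemma norm_dot_le w h : `|dot w h| <= m%:R * `|w| * enorm h.
Proof.
rewrite dotE; apply: (le_trans (ler_norm_sum _ _ _)).
rewrite -[m in m%:R]card_ord -mulrA mulr_natl -sumr_const; apply: ler_sum => i _.
rewrite normrM ler_pM ?norm_entry//.
exact: le_trans (norm_entry h i) (norm_le_enorm h).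
Qed.

(** Membership in the interior becomes a margin uniform over recession directions. One way, [y] is
    moved along [h] itself; the other way, a perturbation [w] changes the pairing by at most m |w|
    times the Euclidean norm of [h], the factor m paying for the sup norm. *)
Lemma interior_DstarP y : (Dstar D)° y <-> exists2 r : R, 0 < r &
  forall h, rec D h -> dot y h <= - (r * enorm h).
Proof.
split=> [/(@nbhs_shift R _ y)[d d0 dP]|[r r0 rP]].
  exists (d / 2); first by rewrite divr_gt0.
  move=> h hD; have [h0|h0] := eqVneq (enorm h) 0.
    by rewrite h0 mulr0 oppr0 (enorm_eq0 _ h0) dot0r.
  have h0' : 0 < enorm h by rewrite lt_neqAle eq_sym h0 enorm_ge0.
  have := dP ((d / 2 / enorm h) *: h) _ h hD.
  rewrite dotDl dotZl -enorm_sqr expr2 mulrA divfK// => /(_ _).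
  rewrite -lerBrDr sub0r; apply.
  have s0 : 0 < d / 2 / enorm h by rewrite !divr_gt0.
  rewrite normrZ gtr0_norm//.
  apply: le_lt_trans (ler_wpM2l (ltW s0) (norm_le_enorm h)) _.
  by rewrite divfK// ltr_pdivrMr//; lra.
have m0 : 0 < m%:R + 1 :> R by rewrite ltr_wpDl.
apply: (@nbhs_of_shift _ _ _ _ (r / (m%:R + 1))); first by rewrite divr_gt0.
move=> w; rewrite ltr_pdivlMr// => wr h hD; rewrite dotDl.
have := rP h hD; have := le_trans (ler_norm _) (norm_dot_le w h).
have : m%:R * `|w| * enorm h <= r * enorm h.
  rewrite ler_wpM2r ?enorm_ge0// (le_trans _ (ltW wr))//.
  by rewrite mulrDr mulr1 mulrC lerDl.
lra.
Qed.

Lemma interior_Dstar_line h : (Dstar D)° !=set0 -> rec D h -> rec D (- h) ->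
  h = 0.
Proof.
move=> [y /interior_DstarP[r r0 rP]] /rP h1 /rP; rewrite dotNr enormN => h2.
apply: enorm_eq0; apply/eqP; rewrite eq_le enorm_ge0 andbT.
by rewrite -(pmulr_rle0 _ r0); lra.
Qed.

Lemma interior_DstarZ y (a : R) : 0 < a -> (Dstar D)° y -> (Dstar D)° (a *: y).
Proof.
move=> a0 /interior_DstarP[r r0 rP]; apply/interior_DstarP.
exists (a * r); first exact: mulr_gt0.
by move=> h /rP hr; rewrite dotZl -mulrA -mulrN ler_pM2l.
Qed.

Lemma interior_rec z h (t : R) : D° z -> rec D h -> 0 <= t -> D° (z + t *: h).
Proof.
move=> /interior_shift[d d0 dP] hD t0; apply: (@nbhs_of_shift _ _ _ _ d) => //.
by move=> w /dP wD; rewrite addrAC; apply: hD.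
Qed.

Hypothesis Dconvex : convex_set (D : set (convex_lmodType 'rV[R]_m)).

Lemma convex_segment x y (t : R) : D x -> D y -> 0 <= t <= 1 ->
  D (x + t *: (y - x)).
Proof.
move=> Dx Dy /andP[t0 t1].
have := Dconvex y x (Itv01 t0 t1); rewrite !inE => /(_ Dy Dx).
rewrite [X in _ -> D X](_ : _ = t *: y + (1 - t) *: x)//.
by apply/rowP => i; rewrite !mxE; ring.
Qed.

Lemma interior_segment x y (t : R) : D° x -> D° y -> 0 <= t <= 1 ->
  D° (x + t *: (y - x)).
Proof.
move=> /interior_shift[d d0 dP] /interior_shift[b b0 bP] t01.
apply: (@nbhs_of_shift _ _ _ _ (Num.min d b)); first by rewrite lt_min d0.
move=> w; rewrite lt_min => /andP[/dP xw /bP yw].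
have := convex_segment _ _ t xw yw t01.
by rewrite opprD addrACA subrr addr0 [x + w + _]addrAC.
Qed.

Hypothesis Dclosed : closed D.

(** The point x + t h is the limit, as s tends to 0, of points on the segments from [x] to the far
    points z + (t / s) h of the given ray. *)
Lemma rec_of_ray z h : (forall t : R, 0 <= t -> D (z + t *: h)) -> rec D h.
Proof.
move=> ray x t Dx t0; apply: closed_approx Dclosed _ => e e0.
have n0 : 0 < `|z - x| + 1 by rewrite ltr_wpDl.
pose s := Num.min 1 (e / (`|z - x| + 1)).
have s0 : 0 < s by rewrite lt_min ltr01 divr_gt0.
have s1 : s <= 1 by rewrite ge_min lexx.
have se : s * (`|z - x| + 1) <= e by rewrite -ler_pdivlMr// ge_min lexx orbT.
exists (x + s *: ((z + (t / s) *: h) - x)).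
  apply: convex_segment => //; last by rewrite (ltW s0).
  by apply: ray; rewrite divr_ge0// ltW.
rewrite [X in `|X|](_ : _ = s *: (z - x)).
  rewrite normrZ gtr0_norm//; apply: lt_le_trans se.
  by rewrite ltr_pM2l// ltrDl.
by apply/rowP => i; rewrite !mxE; field; rewrite gt_eqF.
Qed.

End ConvexDomain.

(** * Barriers *)

(* What self-concordance arguments use of a barrier on U, with gradient g and
   Hessian H. Third derivatives occur only in the form [D^3 Phi(v, v, v)], so the
   bound on the mixed ones by polarization is never needed. *)
Record barrier_field {R : realType} {m : nat} (U : set 'rV[R]_m)
    (g : 'rV[R]_m -> 'rV[R]_m) (H : 'rV[R]_m -> 'M[R]_m) (theta : R) : Prop :=
  BarrierField {
  field_theta : 1 <= theta;
  field_sym : forall z, U z -> (H z)^T = H z;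
  field_ge0 : forall z v, U z -> 0 <= dot (v *m H z) v;
  field_grad : forall z h v, U z ->
    is_derive z v (fun x => dot (g x) h) (dot (h *m H z) v);
  field_hess : forall z v, U z ->
    derivable (fun x => dot (v *m H x) v) z v /\
    `|'D_v (fun x => dot (v *m H x) v) z| <= 2 * norm_by (H z) v ^+ 3;
  field_barrier : forall z h, U z ->
    `|dot (g z) h| <= Num.sqrt theta * norm_by (H z) h }.

Arguments field_theta {R m U g H theta} _.
Arguments field_sym {R m U g H theta} _.
Arguments field_ge0 {R m U g H theta} _.
Arguments field_grad {R m U g H theta} _.
Arguments field_hess {R m U g H theta} _.
Arguments field_barrier {R m U g H theta} _.

Lemma barrier_fieldP {R : realType} {m : nat} {D : set 'rV[R]_m}
    {Phi : 'rV[R]_m -> R} {theta : R} : self_concordant_barrier D Phi theta ->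
  barrier_field D° (grad Phi) (hess Phi) theta.
Proof.
move=> [[Phi3 _ third _] theta1 barrier].
have Uopen : open D° by exact: open_interior.
have Phi1 h : C_on 2 D° ('D_h Phi) by exact: C_on_D Phi3.
have Phi2 h v : C_on 1 D° ('D_v ('D_h Phi)) by exact: C_on_D (Phi1 h).
have gE z h : D° z -> 'D_h Phi z = dot (grad Phi z) h.
  by move=> Uz; exact: derive_gradE Uopen _ _ _ _ Phi3 Uz.
have HE z h v : D° z -> 'D_v ('D_h Phi) z = dot (h *m hess Phi z) v.
  by move=> Uz; exact: derive2_hessE Uopen _ _ _ _ (C_onW _ _ Phi3) Uz.
have nearU z (f f' : 'rV[R]_m -> R) : D° z -> (forall x, D° x -> f x = f' x) ->
    \near z, f z = f' z.
  move=> Uz ff'; apply: (@filterS _ _ _ D°); first exact: ff'.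
  exact: open_nbhs_nbhs.
have grad' z h v : D° z ->
    is_derive z v (fun x => dot (grad Phi x) h) (dot (h *m hess Phi z) v).
  move=> Uz; rewrite -HE//.
  apply: (near_eq_is_derive (f := 'D_h Phi)).
    by apply: nearU => // x; exact: gE.
  exact/derivableP/(C_on_derivable _ _ _ _ (Phi1 h) Uz).
have hess' z v : D° z -> is_derive z v (fun x => dot (v *m hess Phi x) v)
    ('D_v ('D_v ('D_v Phi)) z).
  move=> Uz; apply: (near_eq_is_derive (f := 'D_v ('D_v Phi))).
    by apply: nearU => // x; exact: HE.
  exact/derivableP/(C_on_derivable _ _ _ _ (Phi2 v v) Uz).
split=> //.
- by move=> z Uz; exact: hess_sym Uopen _ _ (C_onW _ _ Phi3) Uz.
- (* If the second derivative along v were negative at z, it would be negative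
     near z; there the barrier inequality forces the first derivative along v
     to vanish, hence the second one too. *)
  move=> z v Uz; rewrite -HE// leNgt; apply/negP => neg.
  have neg2 : 0 < - 'D_v ('D_v Phi) z / 2 by rewrite divr_gt0// oppr_gt0.
  have [d d0 dP] := continuous_shift Uopen _ _ Uz
    (C_on_continuous _ _ _ (Phi2 v v) Uz) _ neg2.
  suff E : 'D_v ('D_v Phi) z = 0 by rewrite E ltxx in neg.
  rewrite (@near_eq_derive _ _ _ _ (fun=> 0)); first exact: derive_cst.
  apply: (nbhs_of_shift _ _ _ d0) => w /dP[Uw].
  rewrite ler_norml => /andP[_ wlt].
  have le0 : 'D_v ('D_v Phi) (z + w) <= 0.
    by move: wlt neg; move: ('D_v ('D_v Phi) z) (_ (z + w)) => a b; lra.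
  apply/eqP; rewrite -normr_le0; have := barrier (z + w) v Uw.
  by rewrite (ler0_sqrtr le0) mulr0.
- move=> z v Uz; split; first exact: (ex_derive (is_derive := hess' z v Uz)).
  rewrite (derive_val (is_derive := hess' z v Uz)) /norm_by -HE//.
  exact: third.
- by move=> z h Uz; rewrite -gE// /norm_by -HE//; exact: barrier.
Qed.

Section BarrierField.
Context {R : realType} {m : nat} {D : set 'rV[R]_m}.
Context {g : 'rV[R]_m -> 'rV[R]_m} {H : 'rV[R]_m -> 'M[R]_m} {theta : R}.
Hypothesis Dconvex : convex_set (D : set (convex_lmodType 'rV[R]_m)).
Hypothesis F : barrier_field D° g H theta.
Implicit Types (z h v w : 'rV[R]_m).
Local Notation lnorm z v := (norm_by (H z) v).

Let theta1 := field_theta F.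
Let theta0 : 0 < theta. Proof. exact: lt_le_trans ltr01 theta1. Qed.

Lemma sqrt_theta_le : Num.sqrt theta <= theta.
Proof.
rewrite -[leRHS]sqr_sqrtr ?(ltW theta0)// expr2 ler_peMr ?sqrtr_ge0//.
by rewrite -sqrtr1 ler_wsqrtr.
Qed.

Lemma norm_by_ge0 (B : 'M[R]_m) v : 0 <= norm_by B v.
Proof. exact: sqrtr_ge0. Qed.

Lemma lnorm_sqr z h : D° z -> lnorm z h ^+ 2 = dot (h *m H z) h.
Proof. by move=> Uz; rewrite sqr_sqrtr// (field_ge0 F). Qed.

Lemma hess_dotC z h v : D° z -> dot (h *m H z) v = dot (v *m H z) h.
Proof. by move=> Uz; rewrite dot_mulmx (field_sym F _ Uz) dotC. Qed.

Lemma hess_cauchy z h v : D° z ->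
  `|dot (h *m H z) v| <= lnorm z h * lnorm z v.
Proof.
move=> Uz; apply: norm_le_of_quadratic => [||t]; try exact: (field_ge0 F).
have := field_ge0 F z (h + t *: v) Uz.
rewrite mulmxDl dotDl !dotDr -scalemxAl !dotZl !dotZr (hess_dotC _ v h Uz).
by move: (dot _ _) (dot _ _) (dot _ _) => a b c; lra.
Qed.

Lemma norm_byE (B : 'M[R]_m) v : norm_by B v = Num.sqrt (dot (v *m B) v).
Proof. by []. Qed.

Lemma norm_by_eq0 (B : 'M[R]_m) v : v *m B = 0 -> norm_by B v = 0.
Proof. by move=> vB; rewrite /norm_by vB dot0l sqrtr0. Qed.

Lemma norm_byZ z v (t : R) : lnorm z (t *: v) = `|t| * lnorm z v.
Proof.
by rewrite /norm_by -scalemxAl dotZl dotZr mulrA -expr2 sqrtrM ?sqr_ge0// sqrtr_sqr.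
Qed.

Lemma line_derivatives z v (b : R) :
  (forall t, 0 <= t <= b -> D° (z + t *: v)) ->
  [/\ forall t : R, 0 <= t <= b ->
        is_derive t 1 (fun t => dot (g (z + t *: v)) v)
          (dot (v *m H (z + t *: v)) v),
      forall t : R, 0 <= t <= b ->
        is_derive t 1 (fun t => dot (v *m H (z + t *: v)) v)
          ('D_v (fun x => dot (v *m H x) v) (z + t *: v)),
      forall t, 0 <= t <= b -> 0 <= dot (v *m H (z + t *: v)) v &
      forall t, 0 <= t <= b -> `|'D_v (fun x => dot (v *m H x) v) (z + t *: v)| <=
        2 * lnorm (z + t *: v) v ^+ 3].
Proof.
move=> Ut; split=> t /Ut Uz.
- have [e1 <-] := field_grad F _ v v Uz.
  exact: (is_derive_line (fun x => dot (g x) v)).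
- exact: (is_derive_line (fun x => dot (v *m H x) v) _ _ _ (field_hess F _ v Uz).1).
- exact: (field_ge0 F).
- exact: (field_hess F _ _ Uz).2.
Qed.

Lemma lnorm_line_le z v (b t : R) :
  (forall s, 0 <= s <= b -> D° (z + s *: v)) -> 0 <= t <= b ->
  lnorm (z + t *: v) v * (1 - t * lnorm z v) <= lnorm z v.
Proof.
move=> Ut tb; have [d1 d2 p0 p3] := line_derivatives _ _ _ Ut.
have b0 : 0 <= b by case/andP: tb => /le_trans; apply.
have := @sqrt_psi_le _ _ _ b b0 d2 p0 p3 t tb.
by rewrite scale0r addr0.
Qed.

Lemma grad_line_growth z v (b t : R) :
  (forall s, 0 <= s <= b -> D° (z + s *: v)) -> 0 <= t <= b ->
  lnorm z v ^+ 2 * t <=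
  (dot (g (z + t *: v)) v - dot (g z) v) * (1 + t * lnorm z v).
Proof.
move=> Ut tb; have [d1 d2 p0 p3] := line_derivatives _ _ _ Ut.
have b0 : 0 <= b by case/andP: tb => /le_trans; apply.
have := @phi_growth _ _ _ _ b b0 d1 d2 p0 p3 t tb.
by rewrite scale0r addr0.
Qed.

Lemma segment_line z v : D° z -> D° (z + v) ->
  forall t : R, 0 <= t <= 1 -> D° (z + t *: v).
Proof.
move=> Uz Uv t t01; have := interior_segment Dconvex _ _ t Uz Uv t01.
by rewrite addrAC subrr add0r.
Qed.

(* The restriction f of <g, v> to the segment satisfies f ^ 2 <= theta f', so
   1 / f decreases by at least 1 / theta along it. *)
Lemma grad_segment_le z v : D° z -> D° (z + v) -> dot (g z) v <= theta.
Proof.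
move=> Uz Uv; have Ut := segment_line _ _ Uz Uv; rewrite leNgt; apply/negP => lt.
have [d1 _ p0 _] := line_derivatives _ _ _ Ut.
pose f (t : R) := dot (g (z + t *: v)) v.
have f0E : f 0 = dot (g z) v by rewrite /f scale0r addr0.
have f0 : 0 < f 0 by rewrite f0E (lt_trans theta0).
have fpos (t : R) : 0 <= t <= 1 -> 0 < f t.
  move=> /andP[t0 t1]; apply: lt_le_trans f0 _; apply: ndecr_cc t0 _ _.
    by move=> x /andP[x0 xt]; apply: d1; rewrite x0 (le_trans xt).
  by move=> x /andP[x0 xt]; apply: p0; rewrite x0 (le_trans xt).
have df (t : R) : 0 <= t <= 1 -> is_derive t 1 (fun t => (f t)^-1)
   (- (f t) ^- 2 *: dot (v *m H (z + t *: v)) v).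
  by move=> t01; apply: (@is_deriveV R f); rewrite ?gt_eqF ?fpos//; exact: d1.
have [t /andP[t0 t1]] := MVT_cc _ _ 0 1 ltr01 df.
have t01 : 0 <= t <= 1 by rewrite !ltW.
have := field_barrier F _ v (Ut t t01).
rewrite -(@ler_pXn2r _ 2) ?nnegrE ?mulr_ge0 ?sqrtr_ge0//.
rewrite exprMn (lnorm_sqr _ v (Ut t t01)) real_normK ?num_real//.
rewrite sqr_sqrtr ?(ltW theta0)// -/(f t) subr0 mulr1 => Hb fE.
have f1 : 0 < (f 1)^-1 by rewrite invr_gt0 fpos// ler01 lexx.
have : theta^-1 <= (f t) ^- 2 *: dot (v *m H (z + t *: v)) v.
  rewrite /GRing.scale/= ler_pdivlMl ?exprn_gt0 ?fpos//.
  by rewrite ler_pdivrMr// mulrC.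
have : (f 0)^-1 < theta^-1 by rewrite ltf_pV2 ?posrE// f0E.
move: fE f1; rewrite scaleNr; move: (_ *: _) (f 0)^-1 (f 1)^-1 => a b c; lra.
Qed.

Lemma grad_rec_le0 z h : D° z -> rec D h -> dot (g z) h <= 0.
Proof.
move=> Uz hD; rewrite leNgt; apply/negP => pos.
have t0 : 0 < (theta + 1) / dot (g z) h by rewrite divr_gt0// addr_gt0.
have := grad_segment_le _ _ Uz (interior_rec _ _ _ Uz hD (ltW t0)).
by rewrite dotZr divfK ?gt_eqF//; lra.
Qed.

(** Along the ray the pairing of the gradient with [h] grows as in [grad_line_growth], yet it never
    becomes positive. Letting the length of the ray tend to infinity leaves r <= - P. *)
Lemma lnorm_rec_le z h : D° z -> rec D h -> lnorm z h <= - dot (g z) h.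
Proof.
move=> Uz hD; rewrite leNgt; apply/negP => lt.
have P0 := grad_rec_le0 _ _ Uz hD.
have Ut t : 0 <= t -> D° (z + t *: h) by exact: interior_rec.
move: lt P0; set P := dot (g z) h; set r := lnorm z h => lt P0.
have r0 : 0 < r by apply: le_lt_trans lt; rewrite oppr_ge0.
(* A length at which the growth bound r^2 t <= - P (1 + t r) fails: the difference of its sides is t
   r (r + P) + P, which equals 1 here. *)
pose t := (- P + 1) / (r * (r + P)).
have rP : 0 < r * (r + P) by rewrite mulr_gt0//; lra.
have t0 : 0 <= t by rewrite divr_ge0 ?(ltW rP)//; lra.
have tE : t * (r * (r + P)) = - P + 1 by rewrite divfK// gt_eqF.
have Utt s : 0 <= s <= t -> D° (z + s *: h) by case/andP => /Ut.
have := grad_line_growth z h t t Utt.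
rewrite t0 lexx => /(_ isT); rewrite -/r -/P.
have := grad_rec_le0 _ _ (Ut t t0) hD.
move: (dot _ _) => Q Q0 HQ.
have : (Q - P) * (1 + t * r) <= - P * (1 + t * r).
  apply: ler_wpM2r; last by lra.
  by apply: addr_ge0 => //; apply: mulr_ge0 => //; exact: ltW.
by clearbody t; lra.
Qed.

(* Along the segment, [q t = - <g, h>] satisfies [|q'| <= |v|_t |h|_t <= |v|_t q]
   with [|v|_t <= r / (1 - t r)], so [q t (1 - t r)] is nonincreasing. *)
Lemma grad_rec_compare z v h : D° z -> D° (z + v) -> lnorm z v < 1 ->
  rec D h -> - dot (g (z + v)) h * (1 - lnorm z v) <= - dot (g z) h.
Proof.
move=> Uz Uv r1 hD; have Ut := segment_line _ _ Uz Uv.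
set r := lnorm z v.
pose q (t : R) := dot (g (z + t *: v)) h * (1 - t * r).
pose dq (t : R) := dot (h *m H (z + t *: v)) v * (1 - t * r)
  - r * dot (g (z + t *: v)) h.
have qd (t : R) : 0 <= t <= 1 -> is_derive t 1 q (dq t).
  move=> t01; have [e1 e2] := field_grad F _ h v (Ut t t01).
  have d1 := is_derive_line (fun x => dot (g x) h) _ _ _ e1.
  have d2 : is_derive t 1 (fun t : R => 1 - t * r) (- r).
    apply/is_deriveP => e e0; exists 1 => // s _.
    rewrite [X in `|X|](_ : _ = 0) ?normr0 ?mulr_ge0 ?(ltW e0)//.
    by rewrite /= [s *: 1]mulr1; ring.
  apply: (is_derive_eq (is_deriveM d1 d2)).
  rewrite /dq e2 /GRing.scale/=.
  by move: (dot _ _) (dot _ _) => a b; ring.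
have dq0 (t : R) : 0 <= t <= 1 -> 0 <= dq t.
  move=> t01; have Utt := Ut t t01.
  have tr : 0 <= 1 - t * r.
    case/andP: t01 => t0 t1; have := ler_pM t0 (norm_by_ge0 (H z) v) t1 (ltW r1).
    by rewrite -/r; lra.
  have := lnorm_line_le _ _ _ _ Ut t01; have := hess_cauchy _ h v Utt.
  have := lnorm_rec_le _ _ Utt hD.
  have := norm_by_ge0 (H (z + t *: v)) v; have := norm_by_ge0 (H (z + t *: v)) h.
  rewrite /dq -/r ler_norml; move: (dot _ _) (dot _ _) (norm_by _ _) (norm_by _ _).
  move=> Hv G nv nh nh0 nv0 hG /andP[Hge _] Nr.
  have : nv * nh * (1 - t * r) <= r * nh.
    by rewrite mulrAC ler_wpM2r.
  have : (- (nh * nv)) * (1 - t * r) <= Hv * (1 - t * r) by rewrite ler_wpM2r.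
  have : r * nh <= r * - G by rewrite ler_wpM2l// norm_by_ge0.
  lra.
have := ndecr_cc _ _ _ _ ler01 qd dq0.
rewrite /q scale0r addr0 scale1r mul0r mul1r subr0.
by move: (dot _ _) (dot _ _) => a b; lra.
Qed.

End BarrierField.

Local Opaque grad hess norm_by dot derive conjugate.

Section Barrier.
Context {R : realType} {m : nat} {D : set 'rV[R]_m} {Phi : 'rV[R]_m -> R}.
Context {theta : R}.
Hypothesis Dclosed : closed D.
Hypothesis Dconvex : convex_set (D : set (convex_lmodType 'rV[R]_m)).
Hypothesis barrier : self_concordant_barrier D Phi theta.
Implicit Types (z h v w : 'rV[R]_m).
Local Notation g := (grad Phi).
Local Notation H := (hess Phi).
Local Notation lnorm z v := (norm_by (H z) v).

Let Uopen : open D°. Proof. exact: open_interior. Qed.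
Let Phi3 : C_on 3 D° Phi. Proof. by case: barrier => -[]. Qed.
Let F : barrier_field D° g H theta. Proof. exact: barrier_fieldP. Qed.
Let theta0 : 0 < theta. Proof. exact: lt_le_trans ltr01 (field_theta F). Qed.

Lemma barrier_derive z v : D° z -> is_derive z v Phi (dot (g z) v).
Proof.
move=> Uz; rewrite -(derive_gradE Uopen _ _ _ _ Phi3 Uz).
exact/derivableP/(C_on_derivable _ _ _ _ Phi3 Uz).
Qed.

Lemma barrier_MVT z v : D° z -> D° (z + v) ->
  exists2 t : R, 0 < t < 1 & Phi (z + v) - Phi z = dot (g (z + t *: v)) v.
Proof.
move=> Uz Uv; have Ut := segment_line Dconvex _ _ Uz Uv.
have [t t01 ->] := MVT_line Phi z v
  (fun t t01 => ex_derive (is_derive := barrier_derive _ v (Ut t t01))).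
have t01' : 0 <= t <= 1 by case/andP: t01 => ? ?; rewrite !ltW.
exists t => //.
exact: (derive_val (is_derive := barrier_derive _ v (Ut t t01'))).
Qed.

Lemma interior_sub z : D° z -> D z.
Proof. exact: interior_subset. Qed.

Lemma barrier_blowup z (M : R) : D z -> ~ D° z ->
  exists2 d : R, 0 < d & forall w, `|w| < d -> D° (z + w) -> M <= Phi (z + w).
Proof.
move=> Dz nUz; case: barrier => -[_ _ _ /(_ z Dz nUz)] + _ _.
by move=> /cvgryPge/(_ M)/nbhs_shift[d d0 dP]; exists d.
Qed.

Let damped_bound (n d r s t S : R) : 0 <= n -> n * (1 - s * r) <= r ->
  0 <= s <= 1 -> 0 <= r < 1 -> `|d| <= S * n -> 0 <= S -> 0 <= t <= 1 ->
  t * d <= S * (r / (1 - r)).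
Proof.
move=> n0 nr /andP[s0 s1] /andP[r0 r1] dS S0 /andP[t0 t1].
have nle : n <= r / (1 - r).
  rewrite ler_pdivlMr ?subr_gt0// (le_trans _ nr)// ler_wpM2l// lerD2l lerN2.
  by rewrite ler_piMl.
apply: le_trans (ler_wpM2l S0 nle); apply: le_trans dS.
by rewrite (le_trans (ler_norm _))// normrM (ger0_norm t0) ler_piMl.
Qed.

(** The bound does not depend on [t]: while the segment stays inside, the local norm of [v] is at
    most r / (1 - r), and the barrier inequality turns this into a slope bound for [Phi]. It is what
    contradicts the blow-up at the boundary. *)
Lemma dikin_bounded z v (t : R) : 0 <= t -> t <= 1 ->
  (forall y, 0 <= y -> y <= t -> D° (z + y *: v)) -> lnorm z v < 1 ->
  Phi (z + t *: v) - Phi z <=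
    Num.sqrt theta * (lnorm z v / (1 - lnorm z v)).
Proof.
move=> t0 t1 Ut r1.
have Uz : D° z by have := Ut 0 (lexx 0) t0; rewrite scale0r addr0.
have [x /andP[x0 x1] ->] := barrier_MVT _ _ Uz (Ut t t0 (lexx t)).
have xt0 : 0 <= x * t by exact: mulr_ge0 (ltW x0) t0.
have xt : x * t <= t by apply: ler_piMl t0 _; exact: ltW.
have line (y : R) : 0 <= y <= t -> D° (z + y *: v) by case/andP => y0 /Ut; exact.
have xtt : 0 <= x * t <= t by rewrite xt0.
rewrite scalerA dotZr; apply: damped_bound (norm_by_ge0 _ _)
  (lnorm_line_le F z v t (x * t) line xtt) _ _ (field_barrier F _ v (line _ xtt)) _ _.
- by rewrite xt0 (le_trans xt t1).
- by rewrite norm_by_ge0 r1.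
- exact: sqrtr_ge0.
- by rewrite t0 t1.
Qed.

(** Let [s] be the supremum of the times up to 1 at which the ray is interior. An interior point at
    time s < 1 could be pushed further, and at a boundary point [Phi] would blow up although it is
    bounded on the way there. *)
Lemma dikin z v : D° z -> lnorm z v < 1 -> D° (z + v).
Proof.
move=> Uz r1; pose S := [set t : R | 0 <= t <= 1 /\ D° (z + t *: v)].
have S0 : S 0 by split; rewrite ?lexx ?ler01// scale0r addr0.
have S1 : ubound S 1 by move=> t [/andP[]].
have Sub : has_ubound S by exists 1.
pose s := sup S.
have Ss t : S t -> t <= s by exact: ub_le_sup.
have s0 : 0 <= s by exact: Ss.
have s1 : s <= 1 by apply: ge_sup => //; exists 0.
have below (t : R) : 0 <= t -> t < s -> D° (z + t *: v).
  move=> t0 ts; have [x [/andP[x0 x1] Ux] tx] := sup_gt (ex_intro _ 0 S0) ts.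
  have t01 : 0 <= t / x <= 1.
    by rewrite divr_ge0//= ler_pdivrMr ?mul1r ?(ltW tx)// (le_lt_trans t0).
  have := segment_line Dconvex _ _ Uz Ux (t / x) t01.
  by rewrite scalerA divfK// gt_eqF// (le_lt_trans t0).
clearbody s; have shift (d : R) : 0 < d -> 0 < s -> exists t : R,
   [/\ 0 <= t, t < s & `|(t - s) *: v| < d].
  move=> d0 sp; have [b b0 bP] := norm_lt_scale v d d0.
  pose e := Num.min s (b / 2).
  have e0 : 0 < e by rewrite lt_min sp divr_gt0.
  have es : e <= s by rewrite ge_min lexx.
  have eb : e < b.
    by rewrite gt_min ltr_pdivrMr//; apply/orP; right; lra.
  exists (s - e); split; [by rewrite subr_ge0|by lra|].
  by apply: bP; rewrite addrAC subrr sub0r normrN gtr0_norm.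
have Ds : D (z + s *: v).
  have [sp|] := ltP 0 s; last first.
    move=> sle; have -> : s = 0 by apply/eqP; rewrite eq_le sle s0.
    by rewrite scale0r addr0; exact: interior_sub.
  apply: closed_approx Dclosed _ => e e0.
  have [t [t0 ts te]] := shift e e0 sp; exists (z + t *: v).
    exact: interior_sub (below t t0 ts).
  by rewrite opprD addrACA subrr add0r -scalerBl.
have [Us|nUs] := pselect (D° (z + s *: v)).
  move: s1; rewrite le_eqVlt => /predU1P[s1|s1].
    by move: Us; rewrite s1 scale1r.
  have [d d0 dP] := open_shift Uopen _ Us.
  have [b b0 bP] := norm_lt_scale v d d0.
  pose e := Num.min (1 - s) (b / 2).
  have e0 : 0 < e by rewrite lt_min subr_gt0 s1 divr_gt0.
  have es : e <= 1 - s by rewrite ge_min lexx.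
  have eb : e < b.
    by rewrite gt_min ltr_pdivrMr//; apply/orP; right; lra.
  have se : (s + e <= s) = false by rewrite gerDl leNgt e0.
  exfalso; move/negP: (negbT se); apply; apply: Ss; split; first by apply/andP;
    split; lra.
  by rewrite scalerDl addrA; apply/dP/bP; rewrite gtr0_norm.
exfalso.
have sp : 0 < s.
  rewrite lt_neqAle s0 andbT; apply/negP => /eqP s0E.
  by apply: nUs; rewrite -s0E scale0r addr0.
pose M := Phi z + Num.sqrt theta * (lnorm z v / (1 - lnorm z v)) + 1.
have [d d0 dP] := barrier_blowup _ M Ds nUs.
have [t [t0 ts td]] := shift d d0 sp.
have Utv := below t t0 ts.
have := dP _ td; rewrite -addrA -scalerDl addrCA subrr addr0 => /(_ Utv).
have t1 : t <= 1 := le_trans (ltW ts) s1.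
have := dikin_bounded z v t t0 t1 (fun y y0 yt => below y y0 (le_lt_trans yt ts)) r1.
by rewrite /M; move: (Phi _) (Phi _) (_ * (_ / _)) => a b c; lra.
Qed.

(** By Dikin's theorem a direction of zero local norm can be followed forever both ways, so it and
    its opposite are recession directions; [interior_Dstar_line] forbids this. *)
Lemma lnorm_eq0 z v : (Dstar D)° !=set0 -> D° z -> lnorm z v = 0 -> v = 0.
Proof.
move=> Dstar0 Uz v0; have ray (t : R) : D (z + t *: v).
  by apply/interior_sub/dikin => //; rewrite norm_byZ v0 mulr0.
apply: (interior_Dstar_line _ Dstar0); apply: (rec_of_ray Dconvex Dclosed z) => t _.
  exact: ray.
by rewrite scalerN -scaleNr.
Qed.

Lemma hess_unit z : (Dstar D)° !=set0 -> D° z -> H z \in unitmx.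
Proof.
move=> Dstar0 Uz; rewrite -row_free_unit -kermx_eq0; apply/rowV0P => v.
move=> /sub_kermxP vH; apply: (lnorm_eq0 _ _ Dstar0 Uz).
exact: norm_by_eq0.
Qed.

(** The pairing of the gradient with [x - z] does not decrease along the segment from [z]. Hence [z]
    attains the supremum defining the conjugate at its own gradient. *)
Lemma critical_max z x : D° z -> D° x ->
  dot (g z) x - Phi x <= dot (g z) z - Phi z.
Proof.
move=> Uz Ux; have Uzx : D° (z + (x - z)) by rewrite addrCA subrr addr0.
have Ut := segment_line Dconvex _ _ Uz Uzx.
have [t /andP[t0 t1]] := barrier_MVT _ _ Uz Uzx.
have t01 : 0 <= t <= 1 by rewrite !ltW.
have := grad_line_growth F _ _ _ _ Ut t01.
rewrite [z + (x - z)]addrCA subrr addr0.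
have : 0 <= lnorm z (x - z) ^+ 2 * t by rewrite mulr_ge0 ?sqr_ge0// ltW.
have n0 : 0 < 1 + t * lnorm z (x - z).
  by rewrite ltr_pwDl// mulr_ge0 ?norm_by_ge0// ltW.
move=> /le_trans/[apply]; rewrite (pmulr_lge0 _ n0) dotBr [dot (g z) (_ - _)]dotBr.
by move: (dot _ _) (dot _ _) (dot _ _) (dot _ _) => a b c d; lra.
Qed.

End Barrier.

(** * The conjugate barrier *)

Section DualPoint.
Context {R : realType} {m : nat} {D : set 'rV[R]_m} {Phi : 'rV[R]_m -> R}.
Context {theta : R}.
Hypothesis Dclosed : closed D.
Hypothesis Dconvex : convex_set (D : set (convex_lmodType 'rV[R]_m)).
Hypothesis barrier : self_concordant_barrier D Phi theta.
Implicit Types (z h v w : 'rV[R]_m).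
Local Notation g := (grad Phi).

Let Uopen : open D°. Proof. exact: open_interior. Qed.
Let Phi3 : C_on 3 D° Phi. Proof. by case: barrier => -[]. Qed.
Let F : barrier_field D° g (hess Phi) theta. Proof. exact: barrier_fieldP. Qed.
Let theta0 : 0 < theta. Proof. exact: lt_le_trans ltr01 (field_theta F). Qed.

Lemma barrier_convex x y (t : R) : D° x -> D° y -> 0 <= t <= 1 ->
  Phi (x + t *: (y - x)) <= Phi x + t * (Phi y - Phi x).
Proof.
move=> Ux Uy /andP[t0 t1]; case: barrier => -[_ convPhi _ _] _ _.
have := convPhi (Itv01 t0 t1) y x; rewrite !inE => /(_ Uy Ux).
rewrite (_ : x + t *: (y - x) = t *: y + (1 - t) *: x); last first.
  by apply/rowP => i; rewrite !mxE; ring.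
rewrite (_ : Phi x + t * (Phi y - Phi x) = t * Phi y + (1 - t) * Phi x)//.
by ring.
Qed.

Definition superlevel w (a : R) := [set z | D° z /\ a <= dot w z - Phi z].

Lemma dot_small w (e : R) : 0 < e ->
  exists2 d : R, 0 < d & forall v, `|v| < d -> `|dot w v| <= e.
Proof.
move=> e0; have K0 : 0 < m%:R * enorm w + 1.
  by rewrite ltr_wpDl// mulr_ge0// enorm_ge0.
exists (e / (m%:R * enorm w + 1)); first exact: divr_gt0.
move=> v; rewrite ltr_pdivlMr// dotC => /ltW ve.
apply: le_trans (norm_dot_le v w) _; apply: le_trans _ ve.
by rewrite mulrAC mulrC ler_wpM2l// lerDl.
Qed.

(** The only danger is a limit point on the boundary of [D], since [D°] is open; there [Phi] tends
    to infinity and the objective drops below [a]. *)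
Lemma superlevel_closed w a : closed (superlevel w a).
Proof.
move=> p clp.
have approx (e : R) : 0 < e -> exists v, superlevel w a (p + v) /\ `|v| < e.
  move=> e0; have [q [Sq]] := clp _ (nbhsx_ballx p e e0).
  rewrite -ball_normE/= => pq; exists (q - p).
  by rewrite addrCA subrr addr0 distrC.
have Dp : D p.
  apply: closed_approx Dclosed _ => e /approx[v [[Uv _] ve]].
  by exists (p + v); [exact: interior_sub | rewrite addrAC subrr add0r].
have [Up|nUp] := pselect (D° p).
  split=> //; rewrite leNgt; apply/negP => Fp.
  pose e := (a - (dot w p - Phi p)) / 3.
  have e0 : 0 < e by rewrite divr_gt0// subr_gt0.
  have [d d0 dP] := dot_small w _ e0.
  have [b b0 bP] := continuous_shift Uopen _ _ Up
    (C_on_continuous _ _ _ Phi3 Up) _ e0.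
  have db0 : 0 < Num.min d b by rewrite lt_min d0.
  have [v [[_ av]]] := approx _ db0.
  rewrite lt_min => /andP[/dP + /bP[_]]; rewrite !ler_norml => /andP[_ wv]
    /andP[Pv _].
  move: av wv Pv e0; rewrite dotDr /e.
  by move: (Phi _) (Phi _) (dot _ _) (dot _ _) => ? ? ? ?; lra.
exfalso; have [d d0 dP] := dot_small w _ ltr01.
have [b b0 bP] := barrier_blowup barrier p (dot w p - a + 2) Dp nUp.
have db0 : 0 < Num.min d b by rewrite lt_min d0.
have [v [[Uv av]]] := approx _ db0.
rewrite lt_min => /andP[/dP + /bP/(_ Uv)]; rewrite ler_norml => /andP[_].
move: av; rewrite dotDr.
by move: (Phi _) (dot _ _) (dot _ _) => ? ? ?; lra.
Qed.

Lemma superlevel_segment w a x y (t : R) : superlevel w a x ->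
  superlevel w a y -> 0 <= t <= 1 -> superlevel w a (x + t *: (y - x)).
Proof.
move=> [Ux Fx] [Uy Fy] t01; split; first exact: interior_segment Dconvex _ _ _
  Ux Uy t01.
have := barrier_convex _ _ _ Ux Uy t01; rewrite dotDr dotZr dotBr.
move: Fx Fy; move: (Phi _) (Phi x) (Phi y) (dot w x) (dot w y) => b c d e f H1 H2.
case/andP: t01 => t0 t1 H3.
have : (1 - t) * a <= (1 - t) * (e - c) by rewrite ler_wpM2l// subr_ge0.
have : t * a <= t * (f - d) by rewrite ler_wpM2l.
lra.
Qed.

(* Along a recession direction h the barrier inequality gives
   [- <Phi'(z + x h), h> <= theta / x], so the objective eventually decreases
   at rate at least [- <w, h> / 2]. *)
Lemma superlevel_no_ray w a z h : superlevel w a z -> rec D h -> dot w h < 0 ->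
  ~ forall t : R, 0 <= t -> superlevel w a (z + t *: h).
Proof.
move=> [Uz _] hD wh ray; set c := - dot w h.
have c0 : 0 < c by rewrite oppr_gt0.
(* Beyond [x0] the bound theta / x on the decrease of [Phi] is at most c / 2. *)
pose x0 := 2 * theta / c; have x00 : 0 < x0 by rewrite divr_gt0// mulr_gt0.
have x0c : c * x0 = 2 * theta by rewrite mulrC divfK// gt_eqF.
pose f (t : R) := dot w (z + t *: h) - Phi (z + t *: h).
have f0 (t : R) : 0 <= t -> a <= f t by case/ray.
(* At rate c / 2 the objective loses f x0 - a + 1 between [x0] and [y], which brings it to a - 1 or
   less. *)
pose y := x0 + 2 * (f x0 - a + 1) / c.
have fa := f0 x0 (ltW x00).
have yx : c * (y - x0) = 2 * (f x0 - a + 1).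
  by rewrite /y addrAC subrr add0r mulrC divfK// gt_eqF.
have yx0 : 0 < y - x0 by rewrite -(pmulr_rgt0 _ c0) yx mulr_gt0//; lra.
have U (t : R) : 0 <= t -> D° (z + t *: h) by case/ray.
have y0 : 0 <= y by lra.
have Uxy : D° (z + x0 *: h + (y - x0) *: h).
  by rewrite -addrA -scalerDl addrCA subrr addr0; exact: U.
have [t /andP[t0 t1]] := barrier_MVT Dconvex barrier _ _ (U x0 (ltW x00)) Uxy.
rewrite -addrA -scalerDl addrCA subrr addr0 scalerA -addrA -scalerDl dotZr.
set s := x0 + t * (y - x0).
have sx : x0 < s by rewrite ltrDl mulr_gt0.
have s0 : 0 < s by exact: lt_trans sx.
have Us := U s (ltW s0).
have := grad_segment_le Dconvex F (z + s *: h) (- (s *: h)) Us.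
rewrite addrK dotNr dotZr => /(_ Uz) gh.
have := f0 y y0; move: fa yx yx0; rewrite /f !dotDr !dotZr.
have -> : dot w h = - c by rewrite opprK.
move: gh x0c; rewrite -/s; clearbody c x0 s y.
move: (dot _ _) (dot _ _) (Phi _) (Phi _) => W G P Q gh x0c fa yx yx0 fy E.
have Gc : - G <= c / 2.
  rewrite -(ler_pM2r x00); have [G0|G0] := leP 0 G.
    by have := mulr_ge0 G0 (ltW x00); have := theta0; lra.
  have : - G * x0 <= - G * s by rewrite ler_wpM2l ?(ltW sx)// oppr_ge0 ltW.
  lra.
have : (y - x0) * - G <= (y - x0) * (c / 2) by rewrite ler_wpM2l// ltW.
move: E gh fa fy yx; lra.
Qed.

(** If the set were unbounded, the unit directions from [z] to ever farther points would cluster at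
    some [u]. By convexity and closedness the whole ray along [u] would lie in the set, which
    [superlevel_no_ray] excludes. *)
Lemma superlevel_bounded w a z : (Dstar D)° w -> superlevel w a z ->
  exists K : R, forall x, superlevel w a x -> `|x| <= K.
Proof.
move=> /interior_DstarP[r r0 rP] Sz; apply: contrapT => unbounded.
have far (k : nat) : exists x, superlevel w a x /\ k%:R < `|x - z|.
  apply: contrapT => nfar; apply: unbounded; exists (k%:R + `|z|) => x Sx.
  rewrite -(subrK z x) (le_trans (ler_normD _ _))// lerD2r leNgt.
  by apply/negP => kx; apply: nfar; exists x.
pose x k := sval (cid (far k)); have xP k := svalP (cid (far k)).
have n0 k : 0 < `|x k - z| by apply: le_lt_trans (xP k).2.
pose h k := `|x k - z|^-1 *: (x k - z).
have h1 k : `|h k| = 1.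
  by rewrite normrZ normfV normr_id mulVf// gt_eqF.
have inS (k : nat) (t : R) : 0 <= t <= k%:R -> superlevel w a (z + t *: h k).
  move=> /andP[t0 tk]; rewrite scalerA; apply: superlevel_segment => //.
    exact: (xP k).1.
  rewrite divr_ge0//= ler_pdivrMr// mul1r (le_trans tk)//; exact: ltW (xP k).2.
have cpt : compact [set v : 'rV[R]_m | `|v| = 1].
  apply: bounded_closed_compact.
    by exists 1; split=> // M M1 v /= ->; exact: ltW.
  move=> v clv; apply/eqP; rewrite eq_le; apply/andP; split.
    apply/ler_addgt0Pr => e /(nbhsx_ballx v)/clv[u [/= u1]].
    rewrite -ball_normE/= => vu; rewrite -u1 -(subrK u v) addrC.
    by rewrite (le_trans (ler_normD _ _))// lerD2l ltW.
  apply/ler_addgt0Pr => e /(nbhsx_ballx v)/clv[u [/= u1]].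
  rewrite -ball_normE/= => vu; rewrite -u1 -(subrK v u).
  by rewrite addrC (le_trans (ler_normD _ _))// lerD2l distrC ltW.
have [u [u1 clu]] := cpt (h @ \oo) _ (filterE _ h1).
have ray (t : R) : 0 <= t -> superlevel w a (z + t *: u).
  move=> t0; apply: closed_approx (superlevel_closed w a) _ => e e0.
  have t10 : 0 < t + 1 by rewrite ltr_wpDl.
  have et : 0 < e / (t + 1) by rewrite divr_gt0.
  have hk : (h @ \oo) [set v | superlevel w a (z + t *: v)].
    have [k tk] : exists k : nat, t <= k%:R.
      by exists (Num.truncn t).+1; rewrite ltW// truncnS_gt.
    exists k => // l /= kl; apply: inS; rewrite t0 (le_trans tk)// ler_nat//.
  have [v [/= Sv]] := clu _ _ hk (nbhsx_ballx u _ et).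
  rewrite -ball_normE/= => uv; exists (z + t *: v) => //.
  rewrite opprD addrACA subrr add0r -scalerBr normrZ ger0_norm// distrC.
  rewrite ltr_pdivlMr// in uv; apply: le_lt_trans uv.
  by rewrite mulrC ler_wpM2l// lerDl.
have uD : rec D u.
  apply: (rec_of_ray Dconvex Dclosed z) => t t0.
  by have [/interior_sub] := ray t t0.
apply: (superlevel_no_ray _ _ _ _ Sz uD _ ray).
apply: le_lt_trans (rP u uD) _; rewrite oppr_lt0 mulr_gt0//.
by apply: lt_le_trans (norm_le_enorm u); rewrite u1.
Qed.

(** The preimage of [w] is a maximizer of <w, x> - Phi x on a compact superlevel set. If its
    gradient were not [w], a small step along the difference would increase the objective without
    leaving the set. *)
Lemma grad_surjective z w : D° z -> (Dstar D)° w -> exists2 x, D° x & g x = w.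
Proof.
move=> Uz wD; set a := dot w z - Phi z.
have Sz : superlevel w a z by split.
have [K KP] := superlevel_bounded _ _ _ wD Sz.
have Scpt : compact (superlevel w a).
  apply: bounded_closed_compact (superlevel_closed w a).
  by exists K; split; [exact: num_real|move=> M KM v /KP/le_trans; apply; exact: ltW].
have [|x] := EVT_max_rV (f := fun x => dot w x - Phi x) (ex_intro _ z Sz) Scpt.
  apply: continuous_in_subspaceT => x; rewrite inE => -[Ux _].
  apply: continuousB; last exact: C_on_continuous Phi3 Ux.
  apply: continuous_of_shift => e /(dot_small w)[d d0 dP]; exists d => // v /dP.
  by rewrite dotDr addrAC subrr add0r.
rewrite inE => -[Ux _] xmax; exists x => //.
apply/esym/eqP; rewrite -subr_eq0; apply/eqP.
set h := w - g x; apply: enorm_eq0; apply/eqP; rewrite -sqrf_eq0 enorm_sqr.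
rewrite eq_le dot_ge0 andbT leNgt; apply/negP => h0.
have h02 : 0 < dot h h / 2 by rewrite divr_gt0.
have [d d0 dP] := (is_deriveP _ _ _ _).1 (barrier_derive barrier x h Ux) _ h02.
have [b b0 bP] := open_shift Uopen _ Ux.
have [c c0 cP] := norm_lt_scale h _ b0.
pose t := Num.min d c / 2.
have t0 : 0 < t by rewrite divr_gt0// lt_min d0.
have td : t < d by rewrite ltr_pdivrMr// gt_min; apply/orP; left; lra.
have tc : t < c by rewrite ltr_pdivrMr// gt_min; apply/orP; right; lra.
have tn : `|t| = t by rewrite gtr0_norm.
have Ut : D° (x + t *: h) by apply/bP/cP; rewrite tn.
have := dP t; rewrite tn => /(_ td); rewrite ler_norml => /andP[_].
have hE : dot h h = dot w h - dot (g x) h by rewrite -dotBl.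
have th : 0 < t * dot h h by rewrite mulr_gt0.
have Fz : dot w z - Phi z <= dot w x - Phi x by apply: xmax; rewrite inE.
have xt : dot w (x + t *: h) - Phi (x + t *: h) <= dot w x - Phi x ->
    dot h h / 2 * t < Phi (x + t *: h) - Phi x - t * dot (g x) h.
  move: hE th; rewrite dotDr dotZr.
  move: (dot h h) (dot w x) (dot w h) (dot _ _) (Phi _) (Phi _) => p1 p2 p3 p4 p5 p6.
  move=> -> th; lra.
have [le|gt] := leP (dot w (x + t *: h) - Phi (x + t *: h)) (dot w x - Phi x).
  by have := xt le; rewrite real_ltNge ?num_real// => /negP.
have Sx : superlevel w a (x + t *: h) by split=> //; exact: le_trans Fz (ltW gt).
by have := xmax _ (mem_set Sx); rewrite /= leNgt gt.
Qed.

End DualPoint.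

Local Transparent grad hess conjugate.

Section Conjugate.
Context {R : realType} {m : nat} {D : set 'rV[R]_m} {Phi : 'rV[R]_m -> R}.
Context {theta : R}.
Hypothesis Dclosed : closed D.
Hypothesis Dconvex : convex_set (D : set (convex_lmodType 'rV[R]_m)).
Hypothesis barrier : self_concordant_barrier D Phi theta.
Implicit Types (z h v w : 'rV[R]_m).
Local Notation g := (grad Phi).
Local Notation H := (hess Phi).
Local Notation lnorm z v := (norm_by (H z) v).
Local Notation e_ i := (delta_mx 0 i : 'rV[R]_m).

Let Uopen : open D°. Proof. exact: open_interior. Qed.
Let Phi3 : C_on 3 D° Phi. Proof. by case: barrier => -[]. Qed.
Let F : barrier_field D° g H theta. Proof. exact: barrier_fieldP. Qed.

Lemma conjugateE z : D° z -> conjugate D Phi (g z) = dot (g z) z - Phi z.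
Proof.
move=> Uz; apply/eqP; rewrite eq_le; apply/andP; split.
  apply: ge_sup; first by exists (dot (g z) z - Phi z), z.
  by move=> _ [x Ux <-]; exact: critical_max Dconvex barrier _ _ Uz Ux.
apply: ub_le_sup; last by exists z.
exists (dot (g z) z - Phi z) => _ [x Ux <-].
exact: critical_max Dconvex barrier _ _ Uz Ux.
Qed.

Hypothesis Dstar0 : (Dstar D)° !=set0.

(** Row i of the inverse Hessian represents the i-th coordinate in the local inner product, which
    lets local norms control coordinates. *)
Lemma dot_inv_hess z (i : 'I_m) v : D° z ->
  dot (row i (invmx (H z)) *m H z) v = v 0 i.
Proof.
move=> Uz; rewrite -row_mul mulVmx ?(hess_unit Dclosed Dconvex barrier)//.
by rewrite row1 dotC dot_delta.
Qed.

(* Self-concordance gives [r ^ 2 <= t * delta_j * (1 + r)] for the displacement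
   delta of local norm r, while [delta_j = O(r)]. *)
Lemma inverse_grad_lipschitz z : D° z -> exists C d : R, [/\ 0 < C, 0 < d &
  forall z' t j, `|t| <= d -> D° z' -> g z' = g z + t *: e_ j ->
    `|z' - z| <= C * `|t|].
Proof.
move=> Uz; pose G := \sum_i lnorm z (row i (invmx (H z))) + 1.
have G0 : 0 < G by rewrite ltr_wpDl// sumr_ge0// => i _; exact: norm_by_ge0.
have entry v i : `|v 0 i| <= G * lnorm z v.
  rewrite -(dot_inv_hess z i v Uz); apply: le_trans (hess_cauchy F _ _ _ Uz) _.
  rewrite ler_wpM2r ?norm_by_ge0// /G (bigD1 i)//= -addrA lerDl.
  by rewrite addr_ge0// sumr_ge0// => j _; exact: norm_by_ge0.
have norm_le v : `|v| <= G * lnorm z v.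
  rewrite [leLHS]/Num.norm/= mx_normrE; apply: bigmax_le.
    by rewrite mulr_ge0 ?(ltW G0) ?norm_by_ge0.
  by move=> [i j] _ /=; rewrite ord1; exact: entry.
exists (G * (2 * G)), (2 * G)^-1; split; rewrite ?invr_gt0 ?mulr_gt0//.
move=> z' t j td Uz' gE; apply: le_trans (norm_le _) _.
rewrite -mulrA ler_pM2l//.
have Uzz : D° (z + (z' - z)) by rewrite addrCA subrr addr0.
have b1 : 0 <= (1 : R) <= 1 by rewrite ler01 lexx.
have := grad_line_growth F z (z' - z) 1 1 (segment_line Dconvex _ _ Uz Uzz) b1.
have zE : z + 1 *: (z' - z) = z' by rewrite scale1r addrCA subrr addr0.
rewrite zE gE dotDl addrAC subrr add0r dotZl dotC dot_delta mulr1 mul1r.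
have := entry (z' - z) j; have := norm_by_ge0 (H z) (z' - z).
move: (norm_by _ _) ((z' - z) 0 j) => r x r0 xr r2.
have tG : `|t| * G <= 2^-1.
  have : `|t| * (2 * G) <= 1 by rewrite -ler_pdivlMr ?mulr_gt0// mul1r.
  lra.
have txr : t * x <= `|t| * (G * r).
  by rewrite (le_trans (ler_norm _))// normrM ler_wpM2l.
have : r ^+ 2 <= `|t| * (G * r) * (1 + r).
  by rewrite (le_trans r2)// ler_wpM2r// addr_ge0.
have [->|rn0] := eqVneq r 0; first by rewrite !mulr_ge0 ?(ltW G0).
have rp : 0 < r by rewrite lt_neqAle eq_sym rn0.
have -> : `|t| * (G * r) * (1 + r) = (`|t| * G * (1 + r)) * r by ring.
rewrite expr2 ler_pM2r// => rle.
have : `|t| * G * r <= 2^-1 * r by rewrite ler_wpM2r.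
lra.
Qed.

(** Let [v] be row i of the inverse Hessian. The increment of ['D_v Phi] from [z] to [z'] is exactly
    t times the entry j of [v], while its linearization is the i-th coordinate of [z' - z]. The
    Lipschitz bound turns an error small relative to [z' - z] into one small relative to [t]. *)
Lemma inverse_grad_derivative z (i : 'I_m) (e : R) : D° z -> 0 < e ->
  exists2 d : R, 0 < d & forall z' t j, `|t| < d -> D° z' ->
    g z' = g z + t *: e_ j ->
    `|z' 0 i - z 0 i - t * invmx (H z) i j| <= e * `|t|.
Proof.
move=> Uz e0; have [C [d [C0 d0 CP]]] := inverse_grad_lipschitz z Uz.
set v := row i (invmx (H z)).
have eC : 0 < e / C by rewrite divr_gt0.
have [b b0 bP] := C1_strict_differentiable Uopen ('D_v Phi) z
  (C_onW _ _ (C_on_D _ _ v Phi3)) Uz _ eC.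
exists (Num.min d (b / C)); first by rewrite lt_min d0 divr_gt0.
move=> z' t j; rewrite lt_min => /andP[td tb] Uz' gE.
have zz' := CP z' t j (ltW td) Uz' gE.
have zb : `|z' - z| < b.
  by apply: le_lt_trans zz' _; rewrite mulrC -ltr_pdivlMr.
have key : `|t * invmx (H z) i j - (z' 0 i - z 0 i)| <= e / C * `|z' - z|.
  have := bP _ zb; rewrite addrCA subrr addr0.
  rewrite !(derive_gradE Uopen _ _ _ _ Phi3)// gE.
  rewrite (derive2_hessE Uopen _ _ _ _ (C_onW _ _ Phi3) Uz) dot_inv_hess//.
  by rewrite dotDl dotZl (dotC (e_ j)) dot_delta !mxE [dot _ _ + _]addrC addrK.
rewrite distrC (le_trans key)//.
by rewrite -mulrA ler_pM2l// mulrC ler_pdivrMr// mulrC.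
Qed.

Lemma grad_shift z (i : 'I_m) : D° z -> (Dstar D)° (g z) ->
  exists2 d : R, 0 < d & forall t : R, `|t| < d -> exists z',
    [/\ D° z', g z' = g z + t *: e_ i & (Dstar D)° (g z')].
Proof.
move=> Uz wD; have [b b0 bP] := open_shift (@open_interior _ (Dstar D)) _ wD.
have [d d0 dP] := norm_lt_scale (e_ i) _ b0.
exists d => // t /dP/bP wt.
by have [z' Uz' gE] := grad_surjective Dclosed Dconvex barrier _ _ Uz wt;
  exists z'; rewrite gE.
Qed.

(** Maximality of [z] and of [z'] for their own gradients squeezes the increment of the conjugate
    between t times the i-th coordinates of [z] and [z']. Continuity of the inverse gradient is then
    enough. *)
Lemma conjugate_partial z (i : 'I_m) : D° z -> (Dstar D)° (g z) ->
  is_derive (g z) (e_ i) (conjugate D Phi) (z 0 i).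
Proof.
move=> Uz wD; apply/is_deriveP => e e0.
have [C [d [C0 d0 CP]]] := inverse_grad_lipschitz z Uz.
have [b b0 bP] := grad_shift z i Uz wD.
exists (Num.min (Num.min d b) (e / C)); first by rewrite !lt_min d0 b0 divr_gt0.
move=> t; rewrite !lt_min => /andP[/andP[td /bP[z' [Uz' gE _]]]].
rewrite ltr_pdivlMr// mulrC => /ltW te.
have := critical_max Dconvex barrier _ _ Uz' Uz.
have := critical_max Dconvex barrier _ _ Uz Uz'.
rewrite -gE (conjugateE _ Uz) (conjugateE _ Uz') gE !dotDl !dotZl.
rewrite !(dotC (e_ i)) !dot_delta.
have := le_trans (norm_entry (z' - z) i) (le_trans (CP z' t i (ltW td) Uz' gE) te).
rewrite !mxE; move: (dot _ _) (dot _ _) (Phi _) (Phi _) (z 0 i) (z' 0 i).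
move=> A B P Q x y xy H1 H2.
apply: (@le_trans _ _ `|t * (y - x)|); last first.
  by rewrite normrM mulrC ler_wpM2r.
rewrite !ger0_norm; lra.
Qed.

Lemma conjugate_hess z : D° z -> (Dstar D)° (g z) ->
  hess (conjugate D Phi) (g z) = invmx (H z).
Proof.
move=> Uz wD; apply/matrixP => i j; rewrite mxE; apply: derive_val.
apply/is_deriveP => e e0.
have [d d0 dP] := inverse_grad_derivative z i e Uz e0.
have [b b0 bP] := grad_shift z j Uz wD.
exists (Num.min d b) => [|t]; rewrite lt_min ?d0// => /andP[td /bP[z' [Uz' gE wD']]].
rewrite -gE (derive_val (is_derive := conjugate_partial z i Uz wD)).
rewrite (derive_val (is_derive := conjugate_partial z' i Uz' wD')).
exact: dP td Uz' gE.
Qed.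

Lemma conjugate_grad z : D° z -> (Dstar D)° (g z) ->
  grad (conjugate D Phi) (g z) = z.
Proof.
move=> Uz wD; apply/rowP => i; rewrite mxE.
exact: (derive_val (is_derive := conjugate_partial z i Uz wD)).
Qed.

End Conjugate.

Local Transparent norm_by dot derive.

(** * Points close to the central path *)

Section CloseToPath.
Context {R : realType} {m : nat} {D : set 'rV[R]_m} {Phi : 'rV[R]_m -> R}.
Context {theta : R}.
Hypothesis Dclosed : closed D.
Hypothesis Dconvex : convex_set (D : set (convex_lmodType 'rV[R]_m)).
Hypothesis barrier : self_concordant_barrier D Phi theta.
Context {w u : 'rV[R]_m} {kappa : R}.
Hypothesis wD : (Dstar D)° w.
Hypothesis uD : D° u.
Hypothesis kappa1 : kappa < 1.
Hypothesis close : norm_by (invmx (hess (conjugate D Phi) w))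
  (u - grad (conjugate D Phi) w) <= kappa.

Let F : barrier_field D° (grad Phi) (hess Phi) theta.
Proof. exact: barrier_fieldP. Qed.

Lemma close_dual_point : exists z, [/\ D° z, grad Phi z = w &
  norm_by (hess Phi z) (u - z) <= kappa].
Proof.
have [z Uz gE] := grad_surjective Dclosed Dconvex barrier _ _ uD wD.
have wD0 : (Dstar D)° !=set0 by exists w.
exists z; split=> //; move: close wD; rewrite -gE => cl gD.
move: cl; rewrite (conjugate_grad Dclosed Dconvex barrier wD0)//.
by rewrite (conjugate_hess Dclosed Dconvex barrier wD0)// invmxK.
Qed.

Lemma close_rec_le h : rec D h ->
  norm_by (hess Phi u) h * (1 - kappa) <= - dot w h.
Proof.
move=> hD; have [z [Uz <- zu]] := close_dual_point.
have Uzu : D° (z + (u - z)) by rewrite addrCA subrr addr0.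
have := grad_rec_compare Dconvex F _ _ _ Uz Uzu (le_lt_trans zu kappa1) hD.
have := lnorm_rec_le Dconvex F _ _ uD hD.
rewrite addrCA subrr addr0 => le1 le2; apply: le_trans le2.
apply: le_trans (ler_wpM2r _ le1); last by rewrite subr_ge0 ltW// (le_lt_trans zu).
by rewrite ler_wpM2l ?norm_by_ge0// lerD2l lerN2.
Qed.

(** Comparing [z0] with [z] costs theta. Replacing [z] by [u] costs at most sqrt theta times kappa,
    hence at most kappa theta because theta >= 1. *)
Lemma close_dot_ge z0 : D° z0 -> dot w z0 - (1 + kappa) * theta <= dot w u.
Proof.
move=> Uz0; have [z [Uz gE zu]] := close_dual_point.
have Uzz : D° (z + (z0 - z)) by rewrite addrCA subrr addr0.
have := grad_segment_le Dconvex F _ _ Uz Uzz; rewrite gE dotBr.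
have := field_barrier F _ (u - z) Uz; rewrite gE ler_norml => /andP[+ _].
rewrite dotBr.
have : Num.sqrt theta * norm_by (hess Phi z) (u - z) <= theta * kappa.
  by apply: ler_pM (sqrtr_ge0 _) (norm_by_ge0 _ _) (sqrt_theta_le F) zu.
move: (_ * norm_by _ _) (dot _ _) (dot _ _) (dot _ _) => a b c d; lra.
Qed.

End CloseToPath.

(** * Projection onto the improving set *)

Section Projection.
Context {R : realType} {m n : nat} (B : 'M[R]_m) (A : 'M[R]_(n, m)).
Context (c : 'rV[R]_n) (b : R) (u : 'rV[R]_m).
Hypothesis Bsym : B^T = B.
Hypothesis Bge0 : forall v, 0 <= dot (v *m B) v.
Hypothesis Beq0 : forall v, dot (v *m B) v = 0 -> v = 0.
Hypothesis Ainj : forall x : 'rV[R]_n, x *m A = 0 -> x = 0.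
Hypothesis c0 : c != 0.

Let G := A *m B *m A^T.

Let dotG x y : dot (x *m G) y = dot (x *m A *m B) (y *m A).
Proof. by rewrite /G !mulmxA dot_mulmx trmxK. Qed.

Let Gunit : G \in unitmx.
Proof.
rewrite -row_free_unit -kermx_eq0; apply/rowV0P => v /sub_kermxP vG.
by apply/Ainj/Beq0; rewrite -dotG vG dot0l.
Qed.

(* The projection [x A] of u onto the image of a half-space, in closed form, with
   the multiplier l of the constraint. *)
Lemma halfspace_kkt : exists x (l : R), [/\ 0 <= l, dot c x <= b,
  l * dot c x = l * b & (u - x *m A) *m B *m A^T = l *: c].
Proof.
pose x1 := u *m B *m A^T *m invmx G; pose q := c *m invmx G.
have x1G : x1 *m G = u *m B *m A^T by rewrite mulmxKV.
have qG : q *m G = c by rewrite mulmxKV.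
have res x : (u - x *m A) *m B *m A^T = u *m B *m A^T - x *m G.
  by rewrite !mulmxBl /G !mulmxA.
have [cx|cx] := leP (dot c x1) b.
  by exists x1, 0; split; rewrite ?mul0r// res x1G subrr scale0r.
have cq : 0 < dot c q.
  rewrite -{1}qG dotG lt_neqAle Bge0 andbT eq_sym; apply/eqP => /Beq0/Ainj q0.
  by move: c0; rewrite -qG q0 mul0mx eqxx.
pose l := (dot c x1 - b) / dot c q.
have l0 : 0 <= l by rewrite divr_ge0 ?subr_ge0 ?ltW.
have cE : dot c (x1 - l *: q) = b.
  by rewrite dotBr dotZr /l divfK ?gt_eqF// opprB addrCA subrr addr0.
exists (x1 - l *: q), l; split; rewrite ?cE//.
by rewrite res mulmxBl x1G -scalemxAl qG opprB addrCA subrr addr0.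
Qed.

(** Against any other feasible [x'], stationarity and complementary slackness make the cross term of
    the squared distance 2 l (b - <c, x'>), which is nonnegative. *)
Lemma kkt_projection x (l : R) : 0 <= l -> dot c x <= b ->
  l * dot c x = l * b -> (u - x *m A) *m B *m A^T = l *: c ->
  is_projection B [set x *m A | x in [set x : 'rV[R]_n | dot c x <= b]]
    u (x *m A).
Proof.
move=> l0 cx slack stat; split; first by exists x.
move=> _ [x' /= cx' <-]; rewrite /norm_by ler_wsqrtr//.
have -> : u - x' *m A = (u - x *m A) + (x - x') *m A.
  by rewrite mulmxBl addrA subrK.
have := stat; move: (u - x *m A) => r rE.
have HC : dot (r *m B) ((x - x') *m A) = l * (b - dot c x').
  by rewrite dotC dot_mulmx rE dotZr dotC dotBr mulrBr slack mulrBr.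
rewrite mulmxDl dotDl !dotDr HC.
have -> : dot ((x - x') *m A *m B) r = l * (b - dot c x').
  by rewrite dot_mulmx Bsym dotC HC.
have := Bge0 ((x - x') *m A); have : 0 <= l * (b - dot c x').
  by rewrite mulr_ge0// subr_ge0.
move: (dot (r *m B) r) (dot ((x - x') *m A *m B) _) (l * _) => p1 p2 p3; lra.
Qed.

(** The residual is (x0 - x) A + z, and stationarity evaluates its pairing with the first summand.
    The shift [z] is thus the only positive contribution when [x0] beats the level [b]. *)
Lemma kkt_distance x0 z x (l : R) : u = x0 *m A + z ->
  l * dot c x = l * b -> (u - x *m A) *m B *m A^T = l *: c ->
  dot ((u - x *m A) *m B) (u - x *m A) =
  dot ((u - x *m A) *m B) z + l * (dot c x0 - b).
Proof.
move=> uE slack stat.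
rewrite {2}uE addrAC -mulmxBl dotDr addrC; congr (_ + _).
by rewrite dotC dot_mulmx stat dotZr dotC dotBr mulrBr slack mulrBr.
Qed.

End Projection.

Section Residual.
Context {R : realType} {m n : nat} {D : set 'rV[R]_m}.
Context (B : 'M[R]_m) (A : 'M[R]_(n, m)) (c : 'rV[R]_n).
Context {y0 y z0 r : 'rV[R]_m} {tau M kappa l delta Bd : R}.
Hypothesis Bsym : B^T = B.
Hypothesis Bge0 : forall v, 0 <= dot (v *m B) v.
Hypothesis tau0 : 0 < tau.
Hypothesis M0 : 0 < M.
Hypothesis kappa1 : kappa < 1.
Hypothesis l0 : 0 <= l.
Hypothesis yD : Dstar D y.
Hypothesis y_rec : forall h, rec D h ->
  norm_by B h * (1 - kappa) <= - dot ((tau / M) *: y) h.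
Hypothesis y_eq : y *m A^T = y0 *m A^T - (tau - 1) *: c.
Hypothesis bounded : forall y' tau', Dstar D y' -> 0 < tau' -> tau' <= tau ->
  y' *m A^T = y0 *m A^T - (tau' - 1) *: c -> enorm y' <= Bd.
Hypothesis stationary : r *m B *m A^T = l *: c.
Hypothesis residual : dot (r *m B) r = dot (r *m B) (tau^-1 *: z0) - l * delta.
Hypothesis M_large : 2 * Bd * enorm z0 < M * (1 - kappa).
Hypothesis delta_large : 4 * Bd * enorm z0 <= tau ^+ 2 * delta.

Let eta := r *m B.
Let rho := norm_by B r.

Let rho_sqr : rho ^+ 2 = dot eta r.
Proof. by rewrite sqr_sqrtr. Qed.

Let y_bound : enorm y <= Bd.
Proof. exact: bounded yD tau0 (lexx _) y_eq. Qed.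

Let Bd0 : 0 <= Bd. Proof. exact: le_trans (enorm_ge0 _) y_bound. Qed.

Let form_cauchy h : dot eta h <= rho * norm_by B h.
Proof.
apply: le_trans (ler_norm _) _; apply: norm_le_of_quadratic => // t.
have := Bge0 (r + t *: h).
rewrite mulmxDl dotDl !dotDr -scalemxAl !dotZl !dotZr.
have -> : dot (h *m B) r = dot eta h by rewrite dot_mulmx Bsym dotC.
by rewrite -/eta; move: (dot eta r) (dot eta h) (dot _ _) => p1 p2 p3; lra.
Qed.

(* The perturbation of y by a small multiple of eta stays in the cone and on the
   feasible affine family, hence within the bound Bd. *)
Let eta_bound (s : R) : 0 < s -> s * rho <= 1 - kappa ->
  M * s * l < tau ^+ 2 -> M * s * enorm eta <= 2 * Bd * tau.
Proof.
move=> s0 srho sl; pose y' := y + (M / tau * s) *: eta.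
have a0 : 0 < M / tau * s by rewrite !mulr_gt0 ?invr_gt0.
have y'D : Dstar D y'.
  move=> h hD; rewrite /y' dotDl dotZl.
  have a1 : 0 < M / tau by rewrite divr_gt0.
  have := ler_wpM2l (ltW a1) (y_rec h hD).
  have aE : M / tau * (tau / M) = 1 by field; rewrite !gt_eqF.
  have : M / tau * (tau / M * dot y h) = dot y h by rewrite mulrA aE mul1r.
  rewrite dotZl.
  have H1 : s * dot eta h <= (1 - kappa) * norm_by B h.
    apply: le_trans (ler_wpM2l (ltW s0) (form_cauchy h)) _.
    by rewrite mulrA ler_wpM2r// sqrtr_ge0.
  have := ler_wpM2l (ltW a1) H1.
  move: (dot y h) (dot eta h) (norm_by B h) (M / tau) (tau / M) => p1 p2 p3 p4
    p5; lra.
have y'E : y' *m A^T = y0 *m A^T - (tau - M / tau * s * l - 1) *: c.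
  rewrite mulmxDl y_eq -scalemxAl stationary scalerA -addrA -scaleNr -scalerDl.
  by rewrite -scaleNr; congr (_ + _ *: _); ring.
have tau' : 0 < tau - M / tau * s * l.
  rewrite subr_gt0 (_ : _ * l = M * s * l / tau); last by ring.
  by rewrite ltr_pdivrMr// -expr2.
have ty : enorm y' <= Bd.
  apply: bounded y'D tau' _ y'E.
  by rewrite gerBl mulr_ge0// ltW.
have : enorm ((M / tau * s) *: eta) <= Bd + Bd.
  rewrite (_ : _ *: _ = y' + - y); last by rewrite /y' addrAC subrr add0r.
  by rewrite (le_trans (enorm_triangle _ _))// enormN lerD.
rewrite enormZ gtr0_norm// (_ : M / tau * s * _ = M * s * enorm eta / tau).
  by rewrite ler_pdivrMr//; lra.
by ring.
Qed.

(** Assume rho >= 1. If the largest step [s] allowed by the cone margin keeps the new tau positive,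
    the bound on eta contradicts [M_large]. Otherwise the step [s'], which halves tau, gives tau
    |eta| <= 4 Bd l; by [delta_large] the residual identity then makes rho^2 nonpositive. The 4 in
    [delta_large] comes from the halving. *)
Lemma residual_lt1 : rho < 1.
Proof.
rewrite ltNge; apply/negP => rho1.
have rho0 : 0 < rho by exact: lt_le_trans rho1.
have Z0 := enorm_ge0 z0; have k0 : 0 < 1 - kappa by rewrite subr_gt0.
have t2 : 0 < tau ^+ 2 by rewrite exprn_gt0.
have delta0 : 0 <= delta.
  rewrite -(pmulr_rge0 _ t2); apply: le_trans delta_large.
  by rewrite !mulr_ge0.
have := residual; rewrite -/eta -rho_sqr dotZr => rE.
have etaz : dot eta z0 <= enorm eta * enorm z0.
  exact: le_trans (ler_norm _) (dot_cauchy _ _).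
pose s := (1 - kappa) / rho.
have s0 : 0 < s by rewrite divr_gt0.
have srho : s * rho = 1 - kappa by rewrite divfK ?gt_eqF.
have rtau : rho ^+ 2 * tau = dot eta z0 - l * delta * tau.
  by rewrite rE mulrBl mulrAC mulVf ?gt_eqF// mul1r.
have [large|small] := ltP (M * s * l) (tau ^+ 2).
  have srle : s * rho <= 1 - kappa by rewrite srho.
  have := ler_wpM2r Z0 (eta_bound s s0 srle large).
  have ld : 0 <= l * delta * tau by rewrite !mulr_ge0// ltW.
  have Ms : 0 < M * s by rewrite mulr_gt0.
  have : M * s * (rho ^+ 2 * tau) <= M * s * (enorm eta * enorm z0).
    by rewrite ler_pM2l// rtau; lra.
  have -> : M * s * (rho ^+ 2 * tau) = M * (s * rho) * rho * tau by ring.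
  rewrite srho => H1 H2.
  have : M * (1 - kappa) * rho * tau <= 2 * Bd * enorm z0 * tau by lra.
  rewrite ler_pM2r// leNgt => /negP; apply.
  by apply: lt_le_trans M_large _; rewrite ler_peMr// mulr_ge0// ltW.
have lp : 0 < l.
  rewrite lt_neqAle l0 andbT; apply/eqP => lE.
  by move: small; rewrite -lE mulr0 leNgt t2.
pose s' := tau ^+ 2 / (2 * M * l).
have s'0 : 0 < s' by rewrite divr_gt0// !mulr_gt0.
have s'E : M * s' * l = tau ^+ 2 / 2 by rewrite /s'; field; rewrite !gt_eqF.
have s's : s' <= s.
  have Ml : 0 < M * l by rewrite mulr_gt0.
  rewrite -(ler_pM2r Ml); have : s * (M * l) = M * s * l by ring.
  have : s' * (M * l) = M * s' * l by ring.
  by rewrite s'E; lra.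
have s'rho : s' * rho <= 1 - kappa by rewrite -srho ler_pM2r.
have s'l : M * s' * l < tau ^+ 2 by rewrite s'E; lra.
have := ler_wpM2r l0 (eta_bound s' s'0 s'rho s'l).
rewrite (_ : M * s' * enorm eta * l = M * s' * l * enorm eta); last by ring.
rewrite s'E => H1.
have H2 : tau * enorm eta <= 4 * Bd * l.
  by rewrite -(ler_pM2r tau0); lra.
have H3 : tau * dot eta z0 <= tau * (l * delta * tau).
  apply: le_trans (ler_wpM2l (ltW tau0) etaz) _.
  have := ler_wpM2r Z0 H2; have := ler_wpM2l l0 delta_large; lra.
have : dot eta z0 <= l * delta * tau by rewrite -(ler_pM2l tau0).
have : 0 < rho ^+ 2 * tau by rewrite mulr_gt0// exprn_gt0.
lra.
Qed.

End Residual.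

(** * Dual feasibility *)

Section DualFeasibility.
Context {R : realType} {m n : nat} {D : set 'rV[R]_m} {A : 'M[R]_(n, m)}.
Context {c h : 'rV[R]_n} {y0 : 'rV[R]_m}.
Hypothesis hD : (rec D)° (h *m A).
Hypothesis ch : dot c h < 0.
Hypothesis y0D : Dstar D y0.
Hypothesis Ainj : forall x : 'rV[R]_n, x *m A = 0 -> x = 0.

Lemma interior_rec_dot (k : 'rV[R]_m) : (rec D)° k -> exists2 r : R, 0 < r &
  forall y, Dstar D y -> r * enorm y <= - dot y k.
Proof.
move=> /(@nbhs_shift R _ k)[d d0 dP]; exists (d / 2); first by rewrite divr_gt0.
move=> y yD; have [y00|yn0] := eqVneq (enorm y) 0.
  by rewrite y00 mulr0 (enorm_eq0 _ y00) dot0l oppr0.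
have yp : 0 < enorm y by rewrite lt_neqAle eq_sym yn0 enorm_ge0.
have s0 : 0 < d / 2 / enorm y by rewrite !divr_gt0.
have /dP/yD : `|(d / 2 / enorm y) *: y| < d.
  rewrite normrZ gtr0_norm//.
  apply: le_lt_trans (ler_wpM2l (ltW s0) (norm_le_enorm y)) _.
  by rewrite divfK// ltr_pdivrMr//; lra.
by rewrite dotDr dotZr -enorm_sqr expr2 mulrA divfK//; lra.
Qed.

Lemma feasible_dot y (t : R) : y *m A^T = y0 *m A^T - (t - 1) *: c ->
  dot y (h *m A) = dot y0 (h *m A) - (t - 1) * dot c h.
Proof.
move=> yE; rewrite dotC dot_mulmx yE dotBr dotZr (dotC h c).
by rewrite [dot y0 _]dotC dot_mulmx.
Qed.

Let td_eq y (t : R) : y *m A^T - y0 *m A^T = - ((t - 1) *: c) <->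
  y *m A^T = y0 *m A^T - (t - 1) *: c.
Proof. by split=> [<-|->]; [rewrite addrCA subrr addr0 | rewrite addrAC subrr
  add0r]. Qed.

(** Pairing a feasible [y] with the recession direction [h *m A] gives a nonpositive number that is
    affine in [t] with positive slope, whence the bound [K]. For y0 = 0 this bound is 1, the case
    where the size of [y0] cannot be divided by. *)
Lemma t_d_fin : exists T : R, [/\ t_d D A c y0 = T%:E, 1 <= T,
  forall y t, 1 <= t -> Dstar D y -> y *m A^T = y0 *m A^T - (t - 1) *: c ->
    t <= T & y0 = 0 -> T <= 1].
Proof.
pose K := 1 + dot y0 (h *m A) / dot c h.
have ub : (t_d D A c y0 <= K%:E)%E.
  apply: ge_ereal_sup => _ [t [t1 [y [yD /td_eq yE]]] <-].
  rewrite lee_fin /K -lerBlDl ler_ndivlMr//.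
  have := yD _ (interior_subset hD); rewrite (feasible_dot _ _ yE); lra.
have mem1 y t : 1 <= t -> Dstar D y -> y *m A^T = y0 *m A^T - (t - 1) *: c ->
    (t%:E <= t_d D A c y0)%E.
  move=> t1 yD yE; apply: ereal_sup_ubound; exists t => //; split=> //.
  by exists y; split=> //; apply/td_eq.
have lb : (1%:E <= t_d D A c y0)%E.
  by apply: (mem1 y0) => //; rewrite subrr scale0r subr0.
have [T TE] : exists T : R, t_d D A c y0 = T%:E.
  by move: lb ub; case: (t_d D A c y0) => [T| |]// _ _; exists T.
exists T; split=> //.
- by rewrite -lee_fin -TE.
- by move=> y t t1 yD yE; rewrite -lee_fin -TE; exact: mem1 yE.
- move=> y00; rewrite -lee_fin -TE (le_trans ub)// lee_fin /K y00 dot0l mul0r.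
  by rewrite addr0.
Qed.

(** An interior recession direction controls the norm of [y] by its pairing with it, and that
    pairing is bounded since t > 0. If no [y] competes, the supremum is minus infinity and [fine]
    returns 0, so nonnegativity still holds. *)
Lemma B_d_fin : 0 <= fine (B_d D A c y0 0) /\
  forall y (t : R), Dstar D y -> 0 < t -> (t%:E < t_d D A c y0)%E ->
    y *m A^T = y0 *m A^T - (t - 1) *: c -> enorm y <= fine (B_d D A c y0 0).
Proof.
have [r r0 rP] := interior_rec_dot _ hD.
have ub : (B_d D A c y0 0 <= (- (dot y0 (h *m A) + dot c h) / r)%:E)%E.
  apply: ge_ereal_sup => _ [y [yD [t [t0 _ yE]]] <-].
  rewrite lee_fin ler_pdivlMr//.
  have := rP y yD; rewrite (feasible_dot _ _ yE).
  by have := nmulr_llt0 t ch; rewrite t0; lra.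
have mem1 y (t : R) : Dstar D y -> 0 < t -> (t%:E < t_d D A c y0)%E ->
    y *m A^T = y0 *m A^T - (t - 1) *: c -> ((enorm y)%:E <= B_d D A c y0 0)%E.
  move=> yD t0 tT yE; apply: ereal_sup_ubound; exists y => //; split=> //.
  by exists t.
split.
  move: mem1; case BE : (B_d D A c y0 0) => [K| |] mem1 //=.
  rewrite leNgt; apply/negP => K0.
  have : ((K - 1)%:E < B_d D A c y0 0)%E by rewrite BE lte_fin; lra.
  move=> /ereal_sup_gt[_ [y [yD [t [t0 tT yE]]] <-] _].
  by have := mem1 y t yD t0 tT yE; rewrite lee_fin; have := enorm_ge0 y; lra.
move=> y t yD t0 tT yE; have := mem1 y t yD t0 tT yE; move: ub.
by case: (B_d D A c y0 0) => [K| |].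
Qed.

(** The adjoint of the injective [A] is onto, so [c] has a preimage [v]; an interior [y] can be
    moved slightly along - v, which raises [t]. Strictness matters because the supremum [B_d] only
    admits parameters below [t_d]. *)
Lemma feasible_lt y (t T : R) : t_d D A c y0 = T%:E -> 1 <= T ->
  (forall y t, 1 <= t -> Dstar D y -> y *m A^T = y0 *m A^T - (t - 1) *: c ->
    t <= T) ->
  (Dstar D)° y -> y *m A^T = y0 *m A^T - (t - 1) *: c -> t < T.
Proof.
move=> TE T1 TP yD yE.
have Gu : A *m A^T \in unitmx.
  rewrite -row_free_unit -kermx_eq0; apply/rowV0P => v /sub_kermxP vG.
  apply/Ainj/enorm_eq0; rewrite /enorm dot_mulmx -mulmxA vG.
  by rewrite dot0r sqrtr0.
pose v := c *m invmx (A *m A^T) *m A.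
have vE : v *m A^T = c by rewrite -mulmxA mulmxKV.
have [d d0 dP] := nbhs_shift _ _ yD.
have [b b0 bP] := norm_lt_scale v _ d0.
pose s := Num.min (b / 2) 1.
have s0 : 0 < s by rewrite lt_min divr_gt0//=.
have sb : s < b by rewrite gt_min ltr_pdivrMr//; apply/orP; left; lra.
(* [TP] only speaks of parameters at least 1; below that, T >= 1 suffices. *)
have [t1|t1] := ltP (t + s) 1; first by lra.
suff : t + s <= T by lra.
apply: (TP (y + (- s) *: v)) => //.
  by apply: dP; apply: bP; rewrite normrN gtr0_norm.
rewrite mulmxDl yE -scalemxAl vE -addrA scaleNr -opprD -scalerDl.
by congr (_ - _ *: _); ring.
Qed.

End DualFeasibility.

Local Opaque norm_by dot grad hess conjugate.

(** * The detector *)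

(* A value of mu above this threshold makes the projection succeed; T and B stand
   for t_d and B_(d,0), Y and Z for the sizes of y0 and z0. *)
Definition mu_threshold {R : realType} (xi kappa theta eps T B Y Z : R) : R :=
  (T * (Y * Z + B * Z + xi) + T ^+ 2 / (theta * eps) + 4 * B * Z) /
    (xi - 1 - kappa) + 2 * B * Z / (1 - kappa) + 1.

Lemma mu_threshold_numerator_ge0 {R : realType} (xi theta eps T B Y Z : R) :
  0 < xi -> 0 < theta -> 0 < eps -> 0 <= T -> 0 <= B -> 0 <= Y -> 0 <= Z ->
  0 <= T * (Y * Z + B * Z + xi) + T ^+ 2 / (theta * eps) + 4 * B * Z.
Proof.
move=> xi0 theta0 eps0 T0 B0 Y0 Z0; rewrite addr_ge0 ?mulr_ge0// addr_ge0//.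
  by rewrite mulr_ge0// !addr_ge0 ?mulr_ge0// ltW.
by rewrite divr_ge0 ?sqr_ge0// mulr_ge0// ltW.
Qed.

Lemma mu_threshold_ge1 {R : realType} (xi kappa theta eps T B Y Z : R) :
  0 < xi -> kappa < 1 -> 0 < xi - 1 - kappa -> 0 < theta -> 0 < eps ->
  0 <= T -> 0 <= B -> 0 <= Y -> 0 <= Z ->
  1 <= mu_threshold xi kappa theta eps T B Y Z.
Proof.
move=> xi0 kappa1 a0 theta0 eps0 T0 B0 Y0 Z0; rewrite lerDr addr_ge0//.
  by rewrite divr_ge0 ?(ltW a0)// mu_threshold_numerator_ge0.
by rewrite divr_ge0 ?mulr_ge0// subr_ge0 ltW.
Qed.

Section Detection.
Context {R : realType} {m n : nat} {D : set 'rV[R]_m} {Phi : 'rV[R]_m -> R}.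
Context {theta xi kappa eps T B : R} {A : 'M[R]_(n, m)} {c : 'rV[R]_n}.
Context {z0 : 'rV[R]_m}.
Hypothesis Dclosed : closed D.
Hypothesis Dconvex : convex_set (D : set (convex_lmodType 'rV[R]_m)).
Hypothesis barrier : self_concordant_barrier D Phi theta.
Hypothesis Ainj : forall x : 'rV[R]_n, x *m A = 0 -> x = 0.
Hypothesis c0 : c != 0.
Hypothesis z0D : D° z0.
Hypothesis xi1 : 1 < xi.
Hypothesis kappa1 : kappa < 1.
Hypothesis xi_kappa : 0 < xi - 1 - kappa.
Hypothesis eps0 : 0 < eps.
Hypothesis T1 : 1 <= T.
Hypothesis B0 : 0 <= B.
Let y0 := grad Phi z0.
Hypothesis tau_lt : forall y tau, (Dstar D)° y ->
  y *m A^T = y0 *m A^T - (tau - 1) *: c -> tau < T.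
Hypothesis y_le : forall y tau, Dstar D y -> 0 < tau -> tau < T ->
  y *m A^T = y0 *m A^T - (tau - 1) *: c -> enorm y <= B.
Context {x : 'rV[R]_n} {tau : R} {y : 'rV[R]_m}.
Hypothesis xyQ : Q_DD D Phi A c z0 (x, tau, y).
Hypothesis close : close_to_path D Phi theta A c xi z0 kappa (x, tau, y).
Let mu0 := mu Phi theta A c xi z0 (x, tau, y).
Let u := primal_point A z0 x tau.
Let Y := enorm y0.
Let Z := enorm z0.
Hypothesis mu_large : mu_threshold xi kappa theta eps T B Y Z <= mu0.

Let F : barrier_field D° (grad Phi) (hess Phi) theta.
Proof. exact: barrier_fieldP. Qed.
Let theta0 : 0 < theta. Proof. exact: lt_le_trans ltr01 (field_theta F). Qed.
Let Y0 : 0 <= Y. Proof. exact: enorm_ge0. Qed.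
Let Z0 : 0 <= Z. Proof. exact: enorm_ge0. Qed.
Let kappa0 : 0 < 1 - kappa. Proof. by rewrite subr_gt0. Qed.
Let T0 : 0 < T. Proof. exact: lt_le_trans ltr01 T1. Qed.
Let xi0 : 0 < xi. Proof. exact: lt_trans ltr01 xi1. Qed.

Let S := T * (Y * Z + B * Z + xi) + T ^+ 2 / (theta * eps) + 4 * B * Z.

Let S0 : 0 <= S.
Proof. exact: mu_threshold_numerator_ge0 xi0 theta0 eps0 (ltW T0) B0 Y0 Z0. Qed.

(** The final 1 in [mu_threshold] is what makes the first and third bounds strict. *)
Let mu_bounds : [/\ 0 < mu0, S <= (xi - 1 - kappa) * mu0 &
  2 * B * Z < mu0 * (1 - kappa)].
Proof.
have a0 : 0 <= S / (xi - 1 - kappa) by rewrite divr_ge0// ltW.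
have b0 : 0 <= 2 * B * Z / (1 - kappa) by rewrite divr_ge0 ?mulr_ge0// ltW.
move: mu_large; rewrite /mu_threshold -/S => mul; split.
- lra.
- rewrite mulrC -ler_pdivrMr//; lra.
- rewrite -ltr_pdivrMr//; lra.
Qed.

Let tau0 : 0 < tau. Proof. by case: xyQ. Qed.
Let uD : D° u. Proof. by case: xyQ. Qed.
Let yD : (Dstar D)° y. Proof. by case: xyQ. Qed.
Let yE : y *m A^T = y0 *m A^T - (tau - 1) *: c.
Proof. by case: xyQ => _ _ <- _; rewrite addrCA subrr addr0. Qed.
Let tauT : tau < T. Proof. exact: tau_lt yD yE. Qed.

Let w := (tau / mu0) *: y.
Let wD : (Dstar D)° w.
Proof. by case: mu_bounds => ? _ _; apply: interior_DstarZ => //; rewrite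
  divr_gt0. Qed.
Let Dstar0 : (Dstar D)° !=set0. Proof. by exists y. Qed.

Let b := - (1 / eps).

Let muE : xi * theta * mu0 =
  tau * (dot y0 z0 + xi * theta - tau * dot c x - dot y u).
Proof.
rewrite /mu0 /mu /y_tau0 -/y0 -/u; field.
by rewrite !gt_eqF.
Qed.

Let yu_ge : tau * dot y z0 - (1 + kappa) * theta * mu0 <= tau * dot y u.
Proof.
have [mup _ _] := mu_bounds.
have := close_dot_ge Dclosed Dconvex barrier wD uD close z0 z0D.
rewrite /w !dotZl => H; have := ler_wpM2l (ltW mup) H.
have cancel p : mu0 * (tau / mu0 * p) = tau * p by field; rewrite gt_eqF.
by rewrite mulrBr !cancel; lra.
Qed.

(** Each summand of [S] pays for one term: the first for the inner products and the constant in the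
    definition of mu, the second for the target level 1 / eps, the last for the margin itself. theta
    >= 1 absorbs the terms that lack this factor. *)
Let objective : 4 * B * Z <= tau ^+ 2 * (b - dot c x).
Proof.
have [mup mul _] := mu_bounds.
have theta1 := field_theta F.
have yz : - (B * Z) <= dot y z0.
  have := dot_cauchy y z0; rewrite ler_norml => /andP[+ _]; apply: le_trans.
  by rewrite lerN2 ler_wpM2r// (y_le _ _ (interior_subset yD) tau0 tauT yE).
have yz0 : dot y0 z0 <= Y * Z by exact: le_trans (ler_norm _) (dot_cauchy _ _).
have bE : tau ^+ 2 * (b - dot c x) = - (tau ^+ 2 / eps) - tau ^+ 2 * dot c x.
  by rewrite /b; ring.
have H1 : (xi - 1 - kappa) * theta * mu0 - tau * (Y * Z + B * Z + xi * theta) <=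
    - (tau ^+ 2 * dot c x).
  have := ler_wpM2l (ltW tau0) yz0; have := ler_wpM2l (ltW tau0) yz.
  have := muE; have := yu_ge; rewrite expr2.
  move: (dot y0 z0) (dot y z0) (dot c x) (dot y u) => p1 p2 p3 p4; lra.
have H2 : S * theta <= (xi - 1 - kappa) * theta * mu0.
  by rewrite mulrAC ler_pM2r.
have H3 : S * theta = theta * (T * (Y * Z + B * Z)) + T * (xi * theta) + T ^+ 2 / eps
    + theta * (4 * B * Z).
  by rewrite /S; field; rewrite !gt_eqF.
have YB0 : 0 <= Y * Z + B * Z by rewrite addr_ge0// mulr_ge0.
have H4 : tau * (Y * Z + B * Z + xi * theta) <= T * (Y * Z + B * Z + xi * theta).
  by rewrite ler_wpM2r ?(ltW tauT)// addr_ge0// mulr_ge0// ltW.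
have H5 : T * (Y * Z + B * Z) <= theta * (T * (Y * Z + B * Z)).
  by rewrite ler_peMl// mulr_ge0// ltW.
have H6 : 4 * B * Z <= theta * (4 * B * Z) by rewrite ler_peMl// !mulr_ge0.
have H7 : tau ^+ 2 / eps <= T ^+ 2 / eps.
  by rewrite ler_pM2r ?invr_gt0// ler_sqr ?nnegrE ?(ltW tau0) ?(ltW T0)// ltW.
rewrite bE; move: H1 H2 H3 H4 H5 H6 H7.
move: (tau ^+ 2 / eps) (T ^+ 2 / eps) (tau ^+ 2 * _) => p1 p2 p3; lra.
Qed.

Lemma detected_point :
  (exists xbar, is_detected_point Phi A c z0 eps (x, tau, y) xbar) /\
  (forall xbar, is_detected_point Phi A c z0 eps (x, tau, y) xbar ->
     D° (xbar *m A) /\ dot c xbar <= - (1 / eps)).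
Proof.
have [mup _ mu2] := mu_bounds.
pose H := hess Phi u.
have Hsym : H^T = H by exact: field_sym F _ uD.
have Hge0 v : 0 <= dot (v *m H) v by exact: field_ge0 F _ _ uD.
have Heq0 v : dot (v *m H) v = 0 -> v = 0.
  move=> v0; apply: (lnorm_eq0 Dclosed Dconvex barrier _ _ Dstar0 uD).
  by rewrite norm_byE v0 sqrtr0.
have [x' [l [l0 cx' slack stat]]] := halfspace_kkt H A c b u Hge0 Heq0 Ainj c0.
have [_ proj] := kkt_projection H A c b u Hsym Hge0 x' l l0 cx' slack stat.
have uE : u = x *m A + tau^-1 *: z0 by [].
have res := kkt_distance H A c b u x (tau^-1 *: z0) x' l uE slack stat.
have lt1 : norm_by H (u - x' *m A) < 1.
  apply: (residual_lt1 H A c Hsym Hge0 tau0 mup kappa1 l0 (interior_subset yD)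
    _ yE _ stat _ mu2 objective).
  - move=> h hD.
    by have := close_rec_le Dclosed Dconvex barrier wD uD kappa1 close h hD.
  - move=> y' tau' y'D t0 tt y'E; apply: y_le y'D t0 _ y'E; exact: le_lt_trans tauT.
  - by rewrite res -mulrN opprB.
split.
  exists x'; split; [by exists x'|exact: proj].
(* Any nearest point is at most as far from [u] as [x' *m A], so it lies in the Dikin ellipsoid
   without an appeal to uniqueness of projections. *)
move=> xbar [[x'' cx'' xA] xbar_min].
have -> : xbar = x''.
  by apply/eqP; rewrite -subr_eq0; apply/eqP/Ainj; rewrite mulmxBl xA subrr.
split; last exact: cx''.
rewrite xA.
have := dikin Dclosed Dconvex barrier u (xbar *m A - u) uD.
rewrite addrCA subrr addr0; apply.
rewrite -opprB -scaleN1r norm_byZ normrN1 mul1r.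
apply: le_lt_trans lt1; apply: xbar_min; exists x' => //.
Qed.

End Detection.

(* The factor [1 + Y^-1] controls T: either T = 1, or B >= Y > 0 and then
   T <= T B / Y (for Y = 0 the inverse is 0, which is harmless as T = 1). *)
Definition threshold_factor {R : realType} (xi kappa Y Z : R) : R :=
  ((1 + Y^-1) * (Y * Z + xi + 1) + 5 * Z) / (xi - 1 - kappa) +
    2 * Z / (1 - kappa) + 1.

Lemma threshold_factor_ge1 {R : realType} (xi kappa Y Z : R) :
  0 < xi -> kappa < 1 -> 0 < xi - 1 - kappa -> 0 <= Y -> 0 <= Z ->
  1 <= threshold_factor xi kappa Y Z.
Proof.
move=> xi0 kappa1 a0 Y0 Z0; rewrite lerDr addr_ge0//.
  apply: divr_ge0 (ltW a0); rewrite addr_ge0 ?mulr_ge0//.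
    by rewrite addr_ge0// invr_ge0.
  by rewrite !addr_ge0 ?mulr_ge0// ltW.
by rewrite divr_ge0 ?mulr_ge0// subr_ge0 ltW.
Qed.

(** Writing X for the maximum, T / (theta eps) and T B are at most X, and T is at most (1 + Y^-1) X.
    The threshold is quadratic in these quantities, hence the square, which merely doubles the
    logarithm. *)
Lemma mu_threshold_le {R : realType} (xi kappa theta eps T B Y Z : R) :
  0 < xi -> kappa < 1 -> 0 < xi - 1 - kappa -> 0 < theta -> 0 < eps ->
  0 <= Y -> 0 <= Z -> 0 <= B -> 1 <= T -> (1 < T -> 0 < Y /\ Y <= B) ->
  mu_threshold xi kappa theta eps T B Y Z <=
  threshold_factor xi kappa Y Z *
    Num.max 1 (1 / (theta * eps) * T + T * B) ^+ 2.
Proof.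
move=> xi0 kappa1 a0 th0 eps0 Y0 Z0 B0 T1 TYB.
have k0 : 0 < 1 - kappa by rewrite subr_gt0.
have T0 : 0 < T by exact: lt_le_trans ltr01 T1.
pose t1 := 1 / (theta * eps) * T.
have t10 : 0 <= t1 by rewrite mulr_ge0 ?divr_ge0 ?mulr_ge0 ?ltW.
have TB0 : 0 <= T * B by rewrite mulr_ge0// ltW.
rewrite -/t1; set X := Num.max 1 _.
have X1 : 1 <= X by rewrite le_max lexx.
have tX : t1 <= X by rewrite le_max lerDl TB0 orbT.
have TBX : T * B <= X by rewrite le_max lerDr t10 orbT.
have X0 : 0 < X by exact: lt_le_trans ltr01 X1.
have XX : X <= X ^+ 2 by rewrite expr2 ler_peMr// ltW.
pose Q := 1 + Y^-1; have Q1 : 1 <= Q by rewrite lerDl invr_ge0.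
have TQ : T <= Q * X.
  move: T1; rewrite le_eqVlt => /predU1P[<-|T1].
    by rewrite -[leLHS]mulr1 ler_pM.
  have [Yp YB] := TYB T1.
  have TY : T <= Y^-1 * X.
    rewrite ler_pdivlMl// mulrC; apply: le_trans _ TBX.
    by rewrite ler_wpM2l// ltW.
  by rewrite (le_trans TY)// /Q mulrDl mul1r lerDr ltW.
have BX : B <= X by apply: le_trans _ TBX; rewrite ler_peMl.
have E1 : T ^+ 2 / (theta * eps) = T * t1 by rewrite /t1; field; rewrite !gt_eqF.
rewrite /mu_threshold /threshold_factor E1 -/Q.
have W1 : 1 <= X ^+ 2 by rewrite (le_trans X1).
clearbody t1 X Q.
have BZ : B * Z <= X ^+ 2 * Z by rewrite ler_wpM2r// (le_trans BX).
have num : T * (Y * Z + B * Z + xi) + T * t1 + 4 * B * Z <=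
    (Q * (Y * Z + xi + 1) + 5 * Z) * X ^+ 2.
  have H1 : T * (Y * Z + xi) <= Q * X ^+ 2 * (Y * Z + xi).
    rewrite ler_wpM2r ?addr_ge0 ?mulr_ge0 ?(ltW xi0)// (le_trans TQ)//.
    by rewrite ler_wpM2l// (le_trans ler01).
  have H2 : T * B * Z <= X ^+ 2 * Z by rewrite ler_wpM2r// (le_trans TBX).
  have H3 : T * t1 <= Q * X * X by rewrite ler_pM// ltW.
  move: H1 H2 H3 BZ; rewrite expr2; lra.
have ia : 0 <= (xi - 1 - kappa)^-1 by rewrite invr_ge0 ltW.
have ik : 0 <= (1 - kappa)^-1 by rewrite invr_ge0 ltW.
have := ler_wpM2r ia num; have := ler_wpM2r ik BZ; move: W1.
move: (xi - 1 - kappa)^-1 (1 - kappa)^-1 (X ^+ 2) => p1 p2 p3.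
move: (_ + 4 * B * Z) (_ + 5 * Z) => p4 p5; lra.
Qed.

(** Taking logarithms, ln M <= ln P + 2 ln (max 1 X), and both terms are absorbed by the maximum in
    the complexity. The + 1 in the constant pays for rounding up to an integer, as sqrt theta and
    the maximum are at least 1. *)
Lemma complexity_bound {R : realType} (gamma theta P X M : R) :
  0 < gamma -> 1 <= theta -> 1 <= P -> 1 <= M -> M <= P * Num.max 1 X ^+ 2 ->
  exists N : nat, N%:R <= ((ln P + 2) / gamma + 1) *
      (Num.sqrt theta * Num.max 1 (ln X)) /\
    forall k : nat, (N <= k)%N -> M <= expR (gamma * k%:R / Num.sqrt theta).
Proof.
move=> gamma0 theta1 P1 M1 MP.
have s1 : 1 <= Num.sqrt theta by rewrite -sqrtr1 ler_wsqrtr.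
have s0 : 0 < Num.sqrt theta by exact: lt_le_trans ltr01 s1.
have P0 : 0 < P by exact: lt_le_trans ltr01 P1.
have M0 : 0 < M by exact: lt_le_trans ltr01 M1.
have X1 : 1 <= Num.max 1 X by rewrite le_max lexx.
have X0 : 0 < Num.max 1 X by exact: lt_le_trans ltr01 X1.
set L := Num.max 1 (ln X); have L1 : 1 <= L by rewrite le_max lexx.
have lnX : ln (Num.max 1 X) <= L.
  rewrite /L; have [X1'|X1'] := leP X 1; last by rewrite le_max lexx orbT.
  by rewrite ln1 le_max ler01.
have lnP : 0 <= ln P by exact: ln_ge0.
have lnM0 : 0 <= ln M by exact: ln_ge0.
have lnM : ln M <= (ln P + 2) * L.
  have : ln M <= ln P + 2 * ln (Num.max 1 X).
    rewrite mulrC mulr_natr -lnXn// -lnM ?posrE ?exprn_gt0//.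
    by rewrite ler_ln ?posrE// mulr_gt0// exprn_gt0.
  have : ln P <= ln P * L by rewrite ler_peMr.
  lra.
pose q := Num.sqrt theta * ln M / gamma.
have q0 : 0 <= q by rewrite divr_ge0 ?mulr_ge0// ltW.
exists (Num.truncn q).+1; split.
  apply: (@le_trans _ _ (q + 1)).
    by rewrite -natr1 lerD2r truncn_le.
  have qE : q = Num.sqrt theta * (ln M / gamma) by rewrite /q mulrA.
  have H1 : ln M / gamma <= (ln P + 2) / gamma * L.
    by rewrite mulrAC ler_pM2r ?invr_gt0.
  have H2 : Num.sqrt theta * (ln M / gamma) <= Num.sqrt theta * ((ln P + 2) /
    gamma * L).
    by rewrite ler_pM2l.
  have H3 : 1 <= Num.sqrt theta * L by rewrite -[leLHS]mulr1 ler_pM.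
  by rewrite qE; lra.
move=> k; rewrite -(ler_nat R) => Nk.
rewrite -[leLHS]lnK ?posrE// ler_expR ler_pdivlMr//.
have : q <= k%:R by apply: le_trans Nk; rewrite ltW// truncnS_gt.
by rewrite /q ler_pdivrMr// mulrC [k%:R * _]mulrC.
Qed.

(* The constant C hidden in the O-symbol depends on the absolute constants
   xi, kappa, gamma and on the Euclidean size of the starting data z0 and
   y0 = Phi'(z0): the quantity inside the logarithm is not invariant under a
   rescaling of R^m, so no bound can hold uniformly in z0 and y0. *)
Theorem proposition7p2 (R : realType) (xi kappa gamma : R)
    (xi_gt1 : 1 < xi) (kappa_lt1 : kappa < 1)
    (xi_kappa : 0 < xi - 1 - kappa) (gamma_gt0 : 0 < gamma) :
  exists C : R -> R -> R,
  forall (m n : nat) (D : set 'rV[R]_m) (Phi : 'rV[R]_m -> R) (theta : R)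
    (A : 'M[R]_(n, m)) (c : 'rV[R]_n) (z0 : 'rV[R]_m),
  closed D ->
  convex_set (D : set (convex_lmodType 'rV[R]_m)) ->
  D° !=set0 ->
  self_concordant_barrier D Phi theta ->
  (forall x : 'rV[R]_n, x *m A = 0 -> x = 0) ->
  D° z0 ->
  strictly_unbounded D A c ->
  forall eps : R, 0 < eps ->
  exists N : nat,
    N%:R <= C (enorm z0) (enorm (grad Phi z0)) *
            detector_complexity D Phi theta A c z0 eps /\
    forall run : nat -> 'rV[R]_n * R * 'rV[R]_m,
    PtPCA_run D Phi theta A c xi z0 kappa gamma run ->
    forall k : nat, (N <= k)%N ->
      (exists xbar, is_detected_point Phi A c z0 eps (run k) xbar) /\
      (forall xbar, is_detected_point Phi A c z0 eps (run k) xbar ->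
         D° (xbar *m A) /\ dot c xbar <= - (1 / eps)).
Proof.
exists (fun Z Y => (ln (threshold_factor xi kappa Y Z) + 2) / gamma + 1).
move=> m n D Phi theta A c z0 Dclosed Dconvex _ barrier Ainj z0D.
move=> [_ [h [hD ch]]] eps eps0.
have F := barrier_fieldP barrier.
have theta1 := field_theta F.
have theta0 : 0 < theta by exact: lt_le_trans ltr01 theta1.
have xi0 : 0 < xi by exact: lt_trans ltr01 xi_gt1.
have c0 : c != 0 by apply/eqP => c0; move: ch; rewrite c0 dot0l ltxx.
set y0 := grad Phi z0.
have y0D : Dstar D y0 by move=> k kD; exact: grad_rec_le0 Dconvex F _ _ z0D kD.
have [T [TE T1 TP T0]] := t_d_fin (A := A) hD ch y0D.
have [B0 BP] := B_d_fin (A := A) (y0 := y0) hD ch.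
set B := fine _ in B0 BP.
(* [y0] itself is dual feasible with tau = 1, so it competes in the supremum [B_d] as soon as T >
   1. *)
have TYB : 1 < T -> 0 < enorm y0 /\ enorm y0 <= B.
  move=> T1'; split.
    rewrite lt_neqAle enorm_ge0 andbT eq_sym; apply/eqP => /enorm_eq0/T0.
    by rewrite leNgt T1'.
  apply: (BP y0 1) => //; first by rewrite TE lte_fin.
  by rewrite subrr scale0r subr0.
have Y0 := enorm_ge0 y0; have Z0 := enorm_ge0 z0.
have MP := mu_threshold_le xi kappa theta eps T B (enorm y0) (enorm z0)
  xi0 kappa_lt1 xi_kappa theta0 eps0 Y0 Z0 B0 T1 TYB.
have P1 := threshold_factor_ge1 xi kappa _ _ xi0 kappa_lt1 xi_kappa Y0 Z0.
have M1 : 1 <= mu_threshold xi kappa theta eps T B (enorm y0) (enorm z0).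
  exact: mu_threshold_ge1 (le_trans ler01 T1) B0 Y0 Z0.
have [N [NC NP]] := complexity_bound gamma theta _ _ _ gamma_gt0 theta1 P1 M1 MP.
exists N; split.
  by rewrite /detector_complexity TE.
move=> run runP k /NP Mk.
have [] := runP k; move: (run k) => [[x tau] y] Q close muk.
apply: (detected_point (T := T) (B := B) Dclosed Dconvex barrier Ainj c0 z0D xi_gt1
  kappa_lt1 xi_kappa eps0 T1 B0 _ _ Q close (le_trans Mk muk)).
- move=> y' tau' y'D y'E.
  exact: feasible_lt Ainj _ _ _ TE T1 TP y'D y'E.
- move=> y' tau' y'D t0 tT y'E; apply: (BP y' tau') => //.
  by rewrite TE lte_fin.
Qed.
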